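(* Let $X=\{X_0,X_1,\ldots\}$ be a Harris ergodic Markov chain on $\mathsf{X}$ with invariant distribution $\pi$ (with arbitrary initial distribution). If $X$ is polynomially ergodic of order $m>1$ and if $\sigma^2(\xi_q)>0$, then as $n\to\infty$ \[ \sqrt{n}(\hat{\xi}_{n,q}-\xi_q)\stackrel{d}{\to}\mathrm{N}\left(0,\ \sigma^2(\xi_q)/[f_V(\xi_q)]^2\right). \]
   Context: $\pi$ is a probability distribution with support $\mathsf{X}\subseteq\mathbb{R}^d$, $d\ge1$; $P^n(x,A)=\Pr(X_{k+n}\in A\mid X_k=x)$. Harris ergodic means $\pi$-irreducible, aperiodic and positive Harris recurrent. $X$ is polynomially ergodic of order $m>0$ if there is $M:\mathsf{X}\to\mathbb{R}^+$ with $E_\pi M<\infty$ such that $\|P^n(x,\cdot)-\pi(\cdot)\|\le M(x)n^{-m}$ for all $x\in\mathsf{X}$, $n\in\{1,2,\ldots\}$, where $\|\cdot\|$ is the total variation norm. The function $g:\mathsf{X}\to\mathbb{R}$ is measurable, $V=g(W)$ with $W\sim\pi$, $F_V$ is the distribution function of $V$, $0<q<1$, and $\xi_q=\inf\{v:F_V(v)\ge q\}$. It is assumed that $F_V$ is absolutely continuous with continuous density $f_V$ satisfying $0<f_V(\xi_q)<\infty$. Set $Y_i=g(X_i)$, let $Y_{n(j)}$ be the $j$th order statistic of $Y_0,\ldots,Y_{n-1}$, and $\hat{\xi}_{n,q}=Y_{n(j)}$ where $j$ is the integer with $j-1<nq\le j$. For $y\in\mathbb{R}$, \[ \sigma^2(y)=\mathrm{Var}_\pi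 I(Y_0\le y)+2\sum_{k=1}^\infty\mathrm{Cov}_\pi[I(Y_0\le y),I(Y_k\le y)], \] where the subscript $\pi$ means the variance and covariances are computed for the stationary chain ($X_0\sim\pi$), and $I(\cdot)$ is the indicator. *)

(* Defs.v *)
From HB Require Import structures.
From mathcomp Require Import all_boot all_order all_algebra.
From mathcomp Require Import all_classical all_reals all_analysis.
From mathcomp Require Import measurable_realfun.

Set Implicit Arguments.
Unset Strict Implicit.
Unset Printing Implicit Defensive.

Import Order.TTheory GRing.Theory Num.Theory.
Import numFieldNormedType.Exports.

Local Open Scope classical_set_scope.
Local Open Scope ring_scope.

(* A nonempty subset of R^d as a measurable space, with the trace of the Borel
   (product) sigma-algebra of d.-tuple R. Nonemptiness is only there because
   measurable types are pointed. *)
Definition state (R : realType) (d : nat) (X : set (d.-tuple R))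
  of X !=set0 : Type := {x : d.-tuple R | x \in X}.

Section state_measurable.
Context (R : realType) (d : nat) (X : set (d.-tuple R)) (X0 : X !=set0).

HB.instance Definition _ := Choice.on (state X0).

Let state_point : state X0 :=
  exist _ (projT1 (cid X0)) (mem_set (projT2 (cid X0))).

HB.instance Definition _ := isPointed.Build (state X0) state_point.

Definition state_val (x : state X0) : d.-tuple R := sval x.

HB.instance Definition _ :=
  Measurable.copy (state X0) (g_sigma_algebra_preimageType state_val).

(* X carries pi by construction; what remains of "pi has support X" is that
   every neighbourhood of every point of X is charged, so that the closure of X
   is the topological support of pi. X itself is not required to be closed. *)
Definition full_support (pi : probability (state X0) R) : Prop :=
  forall (x : state X0) (e : R), 0 < e ->
    (0 < pi [set y | forall i : 'I_d,
      (`|tnth (state_val y) i - tnth (state_val x) i| < e)%R])%E.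

End state_measurable.

Section nstep_kernel.
Context d (S : measurableType d) (R : realType).
Local Open Scope ereal_scope.

Section mkcomp_noparam_probability.
Variables k1 k2 : R.-pker S ~> S.

Let mkcomp_noparam_setT x : mkcomp_noparam k1 k2 x [set: S] = 1.
Proof.
rewrite [LHS](_ : _ = \int[k1 x]_y cst 1 y).
  by rewrite integral_cst// mul1e prob_kernel.
by apply: eq_integral => y _; exact: prob_kernel.
Qed.

HB.instance Definition _ := isProbabilityKernel.Build _ _ _ _ _
  (mkcomp_noparam k1 k2) mkcomp_noparam_setT.

End mkcomp_noparam_probability.

Fixpoint nstep (P : R.-pker S ~> S) (n : nat) : R.-pker S ~> S :=
  if n is n'.+1 then mkcomp_noparam P (nstep P n')
  else kdirac (@measurable_id _ S setT).

End nstep_kernel.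

Section pair_law.
Context d (S : measurableType d) (R : realType).
Variables (pi : probability S R) (K : R.-pker S ~> S).
Local Open Scope ereal_scope.

(* Law of (X, Y) when X has law pi and Y has law K x given X = x. *)
Definition pair_law (A : set (S * S)) : \bar R := \int[pi]_x K x (xsection A x).

Let pair_law0 : pair_law set0 = 0.
Proof. by apply: integral0_eq => x _; rewrite xsection0 measure0. Qed.

Let pair_law_ge0 A : 0 <= pair_law A.
Proof. by apply: integral_ge0 => x _; exact: measure_ge0. Qed.

Let pair_law_sigma_additive : semi_sigma_additive pair_law.
Proof.
move=> F mF tF mUF.
have -> : pair_law (\bigcup_n F n) = \sum_(0 <= n <oo) pair_law (F n).
  rewrite /pair_law -integral_nneseries//; last first.
    by move=> n; apply: measurable_fun_xsection_finite_kernel; rewrite inE; exact: mF.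
  apply: eq_integral => x _; rewrite xsection_bigcup measure_semi_bigcup//.
  - by move=> n; exact: measurable_xsection.
  - exact: trivIset_xsection.
  - by apply: bigcup_measurable => n _; exact: measurable_xsection.
by apply: is_cvg_nneseries => n _ _; exact: pair_law_ge0.
Qed.

HB.instance Definition _ := isMeasure.Build _ _ _ pair_law
  pair_law0 pair_law_ge0 pair_law_sigma_additive.

Let pair_law_setT : pair_law [set: S * S] = 1.
Proof.
rewrite [LHS](_ : _ = \int[pi]_x cst 1 x).
  by rewrite integral_cst// mul1e; exact: probability_setT.
by apply: eq_integral => x _; rewrite xsectionE preimage_setT prob_kernel.
Qed.

HB.instance Definition _ := Measure_isProbability.Build _ _ _ pair_law
  pair_law_setT.

End pair_law.

Section markov_chains.
Context dO (Omega : measurableType dO) d (S : measurableType d) (R : realType).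
Variable Pr : probability Omega R.

Definition history (X : nat -> {RV Pr >-> S}) (n : nat) : set (set Omega) :=
  <<s \bigcup_(i in [set i | (i <= n)%N])
        preimage_set_system setT (X i) measurable >>.

(* P(X_n, B) is a version of Pr(X_{n+1} \in B | X_0, ..., X_n); the law of X_0
   is unconstrained. *)
Definition markov_chain (P : R.-pker S ~> S) (X : nat -> {RV Pr >-> S}) :
    Prop :=
  forall (n : nat) (E : set Omega) (B : set S),
    history X n E -> measurable B ->
    Pr (E `&` X n.+1 @^-1` B) = (\int[Pr]_(w in E) P (X n w) B)%E.

End markov_chains.

Definition total_variation d (S : measurableType d) (R : realType)
    (mu nu : set S -> \bar R) : \bar R :=
  ereal_sup [set `|mu A - nu A|%E | A in measurable].

Section ergodicity.
Context d (S : measurableType d) (R : realType).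
Variables (P : R.-pker S ~> S) (pi : probability S R).
Local Open Scope ereal_scope.

Definition invariant_distribution : Prop :=
  forall A, measurable A -> \int[pi]_x P x A = pi A.

Definition pi_irreducible : Prop :=
  forall (x : S) (A : set S), measurable A -> 0 < pi A ->
    exists2 n : nat, (0 < n)%N & 0 < nstep P n x A.

Definition aperiodic : Prop :=
  forall (p : nat) (D : nat -> set S), (2 <= p)%N ->
    (forall i, (i < p)%N -> measurable (D i)) -> trivIset `I_p D ->
    (forall i x, (i < p)%N -> D i x -> P x (D (i.+1 %% p)%N) = 1) ->
    pi (D 0%N) = 0.

Definition harris_recurrent : Prop :=
  forall (x : S) (A : set S), measurable A -> 0 < pi A ->
  forall (dO : measure_display) (Omega : measurableType dO)
    (Pr : probability Omega R) (X : nat -> {RV Pr >-> S}),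
    markov_chain P X ->
    (forall B, measurable B -> distribution Pr (X 0%N) B = \d_x B) ->
    Pr (lim_sup_set (fun n => X n @^-1` A)) = 1.

(* "Positive" is the invariance of the probability pi. *)
Definition harris_ergodic : Prop :=
  [/\ pi_irreducible, aperiodic, harris_recurrent & invariant_distribution].

Definition polynomially_ergodic (m : R) : Prop :=
  exists M : S -> R,
    [/\ measurable_fun setT M, (forall x, 0 <= M x)%R,
        \int[pi]_x (M x)%:E < +oo &
        forall (x : S) (n : nat), (0 < n)%N ->
          total_variation (nstep P n x) pi <= (M x * n%:R `^ (- m))%:E].

End ergodicity.

Section quantiles.
Context d (S : measurableType d) (R : realType).
Variables (P : R.-pker S ~> S) (pi : probability S R) (g : {RV pi >-> R}).

Definition quantile (q : R) : R := inf [set v | (q%:E <= cdf g v)%E].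

Definition asymptotic_variance (y : R) : R :=
  let I (x : S) : R := \1_[set z | g z <= y] x in
  fine 'V_pi[I] +
  2 * limn (fun n => \sum_(1 <= k < n)
        fine (covariance (pair_law pi (nstep P k)) (I \o fst) (I \o snd))).

Definition continuous_density (f : R -> R) : Prop :=
  [/\ (forall v, 0 <= f v), continuous f &
      forall v, cdf g v = (\int[lebesgue_measure]_(t in `]-oo, v]) (f t)%:E)%E].

End quantiles.

Section order_statistics.
Context dO (Omega : measurableType dO) (R : realType).
Variables (Pr : probability Omega R) (Y : nat -> {RV Pr >-> R}).

Definition order_statistic (n j : nat) (w : Omega) : R :=
  nth 0 (sort <=%O [seq Y i w | i <- iota 0 n]) j.-1.

Let nth_sort_le (s : seq R) (j : nat) (x : R) : (j < size s)%N ->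
  (nth 0 (sort <=%O s) j <= x) = (j < count (fun y : R => (y <= x)%R) s)%N.
Proof.
move=> js.
rewrite -(permP (permEl (perm_sort <=%O s)) (fun y : R => y <= x)).
have : sorted <=%O (sort <=%O s) by exact: (sort_sorted (@le_total _ R)).
move: js; rewrite -(size_sort <=%O s); move: (sort _ _) => t {s}.
elim: t j => [//|a t IH] [|j] /=.
  move=> _ pt; case: (leP a x) => ax; first by [].
  rewrite add0n; apply/esym/negbTE; rewrite -leqNgt leqn0 -leqn0 leqNgt -has_count.
  apply/negP => /hasP[y yt yx].
  move: pt; rewrite (path_sortedE (@le_trans _ R)) => /andP[/allP/(_ _ yt) ay _].
  by have := lt_le_trans ax (le_trans ay yx); rewrite ltxx.
rewrite ltnS => jt pt; rewrite IH//; last exact: path_sorted pt.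
case: (leP a x) => ax; first by rewrite add1n ltnS.
rewrite add0n; suff -> : count (fun y : R => (y <= x)%R) t = 0%N by [].
apply/eqP; rewrite -leqn0 leqNgt -has_count; apply/negP => /hasP[y yt yx].
move: pt; rewrite (path_sortedE (@le_trans _ R)) => /andP[/allP/(_ _ yt) ay _].
by have := lt_le_trans ax (le_trans ay yx); rewrite ltxx.
Qed.

Let measurable_order_statistic n j :
  measurable_fun [set: Omega] (order_statistic n j).
Proof.
rewrite /order_statistic; have [jn|nj] := ltnP j.-1 n; last first.
  rewrite (_ : (fun _ => _) = cst 0)//; apply/funext => w.
  by rewrite nth_default// size_sort size_map size_iota.
apply: (measurability _ (RGenOInfty.measurableE R)) => // _ [_ [x ->] <-].
pose F w : R := \sum_(i <- iota 0 n) \1_(Y i @^-1` `]-oo, x]) w.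
have mF : measurable_fun setT F.
  apply: measurable_sum => i; apply: measurable_indic.
  by rewrite -[X in measurable X]setTI; exact: measurable_funP.
have FE w : F w = (count (fun y : R => (y <= x)%R) [seq Y i w | i <- iota 0 n])%:R.
  rewrite /F count_map -sum1_count natr_sum [RHS]big_mkcond/=.
  apply: eq_bigr => i _; rewrite indicE.
  case: ifPn => Yx; first by rewrite mem_set//= in_itv.
  by rewrite memNset//= in_itv/=; exact/negP.
rewrite (_ : _ @^-1` _ = F @^-1` `]-oo, j.-1%:R]).
  by apply: mF.
apply/seteqP; split => w /=; rewrite !in_itv/= andbT FE ler_nat;
  by rewrite ltNge nth_sort_le ?size_map ?size_iota// -leqNgt.
Qed.

HB.instance Definition _ n j := isMeasurableFun.Build _ _ _ _
  (order_statistic n j) (@measurable_order_statistic n j).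

(* Num.ceil (n q) is the integer j with j - 1 < n q <= j; it is positive when
   0 < n and 0 < q. *)
Definition sample_quantile (q : R) (n : nat) : Omega -> R :=
  order_statistic n `|Num.ceil (n%:R * q)|%N.

HB.instance Definition _ q n := MeasurableFun.on (sample_quantile q n).

Definition scaled_error (q xi : R) (n : nat) (w : Omega) : R :=
  Num.sqrt n%:R * (sample_quantile q n w - xi).

Let measurable_scaled_error q xi n : measurable_fun setT (scaled_error q xi n).
Proof. by apply: measurable_funM => //; exact: measurable_funB. Qed.

HB.instance Definition _ q xi n := isMeasurableFun.Build _ _ _ _
  (scaled_error q xi n) (@measurable_scaled_error q xi n).

End order_statistics.

Definition cvg_in_distribution dO (Omega : measurableType dO) (R : realType)
    (Pr : probability Omega R) (Z : nat -> {RV Pr >-> R})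
    (mu : probability (measurableTypeR R) R) : Prop :=
  forall x : R, {for x, continuous (fun t : R => mu `]-oo, t]%classic)} ->
    cdf (Z n) x @[n --> \oo] --> mu `]-oo, x]%classic.

(* Main.v *)
From HB Require Import structures.
Require Import Defs.
From mathcomp Require Import all_boot all_order all_algebra.
From mathcomp Require Import all_classical all_reals all_analysis.
From mathcomp Require Import measurable_realfun.
From mathcomp Require Import ring lra.

Set Implicit Arguments.
Unset Strict Implicit.
Unset Printing Implicit Defensive.

Import Order.TTheory GRing.Theory Num.Theory.
Import numFieldNormedType.Exports.

Local Open Scope classical_set_scope.
Local Open Scope ring_scope.

(** Let xi be the q-quantile, F the distribution function of V and j the rank of
    the order statistic.  The event {sqrt n (xihat_n - xi) <= x} says that at
    least j of Y_0, ..., Y_(n-1) are below y_n = xi + x / sqrt n, that is,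
    A_n <= d_n, where

      h_n = F(y_n) - I(g <= y_n),   A_n = n^(-1/2) (h_n(X_0) + ... + h_n(X_(n-1))),
      d_n = n^(-1/2) (n F(y_n) - j)

    ([scaled_error_le]).  Since F'(xi) = f(xi), d_n tends to x f(xi)
    ([cvg_threshold]), so it suffices that A_n is asymptotically normal with
    variance sigma^2(xi): the limit is then Phi (x f(xi) / sigma(xi)).

    This central limit theorem for a triangular array ([triangular_clt]) is
    proved on the given chain, without stationarity, by Lindeberg's method.  The
    indicator of A_n <= c is smoothed into u(v, x) = Phi ((c - x) / sqrt v),
    which solves the heat equation u_v = u_xx / 2 and has bounded derivatives for
    v away from 0 ([heat_test_smooth]).  With v_i = v_0 + (n - i) sigma^2 / n and
    A_i the normalised sum of the first i terms, E u(v_i, A_i) moves from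
    u(v_0 + sigma^2, 0) to E u(v_0, A_n), and one shows that the n increments
    have a negligible sum ([lindeberg_step], [lindeberg]).  In the i-th
    increment, u is expanded around the sum A' of the terms older than a window
    of 2 l steps.  The linear term is small by mixing; in the quadratic term,
    h_n(X_i) is paired with the terms of the window, and those at lag at most l
    produce the variance truncated at lag l ([quadratic_term]), which balances
    the heat term; the cubic term is bounded by the second moment of a window,
    of order l / n ([window_second_moment]).  The errors vanish as soon as
    l = o(n^(1/2)) and n^(1/2) l^(-m) -> 0, and m > 1 leaves room for such an l
    ([window_lengths]).

    Mixing is used in one form only ([mixing]): for Z bounded and determined by
    X_0, ..., X_t, |E[Z H(X_(t+k))] - E[Z] pi(H)| is at most a constant times
    k^(-m) + t^(-m).  By the Markov property the left-hand side involves
    |P^k H - pi(H)|(X_t) <= 2 min (1, M(X_t) k^(-m)).  Under pi the mean of this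
    bound is at most 2 pi(M) k^(-m); the law of X_t is compared with pi in total
    variation, at distance at most M(X_0) t^(-m).  As M(X_0) need not be
    integrable, everything is weighted by the indicator of {M(X_0) <= K}, whose
    probability tends to 1 as K grows.

    The indicators h_n vary with n, but the truncated variance is Lipschitz in h
    for the norm of L^1(pi), with constant of order l, whereas h_n is at distance
    of order n^(-1/2) from its limit ([truncated_variance_lipschitz],
    [centred_distance]); so l = o(n^(1/2)) also gives the convergence of the
    variances. *)

(** * Bounded measurable functions *)

Definition bmf d (T : measurableType d) (R : realType) (f : T -> R) : Prop :=
  measurable_fun setT f /\ exists K, forall x, `|f x| <= K.

Section bounded_measurable.
Context d (T : measurableType d) (R : realType).
Implicit Types (f g : T -> R) (a : R).

Lemma bmf_cst a : bmf (fun _ : T => a).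
Proof. by split=> //; exists `|a|. Qed.

Lemma bmfD f g : bmf f -> bmf g -> bmf (fun x => f x + g x).
Proof.
move=> [mf [K fK]] [mg [L gL]]; split; first exact: measurable_funD.
by exists (K + L) => x; rewrite (le_trans (ler_normD _ _))// lerD.
Qed.

Lemma bmfM f g : bmf f -> bmf g -> bmf (fun x => f x * g x).
Proof.
move=> [mf [K fK]] [mg [L gL]]; split; first exact: measurable_funM.
by exists (K * L) => x; rewrite normrM ler_pM.
Qed.

Lemma bmfZ a f : bmf f -> bmf (fun x => a * f x).
Proof. by apply: bmfM; exact: bmf_cst. Qed.

Lemma bmfB f g : bmf f -> bmf g -> bmf (fun x => f x - g x).
Proof.
move=> bf bg; rewrite (_ : (fun x => _) = fun x => f x + (-1) * g x).
  by apply: bmfD => //; exact: bmfZ.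
by apply/funext => x; rewrite mulN1r.
Qed.

Lemma bmf_norm f : bmf f -> bmf (fun x => `|f x|).
Proof.
move=> [mf [K fK]]; split; first exact: measurableT_comp.
by exists K => x; rewrite normr_id.
Qed.

Lemma bmf_indic (A : set T) : measurable A -> bmf (\1_A : T -> R).
Proof.
move=> mA; split; first exact: measurable_indic.
by exists 1 => x; rewrite indicE; case: (x \in A); rewrite ?normr1 ?normr0.
Qed.

Lemma measurable_superlevel f a : measurable_fun setT f ->
  measurable [set x | a <= f x].
Proof.
move=> mf; rewrite (_ : mkset _ = f @^-1` `[a, +oo[%classic).
  by rewrite -[X in measurable X]setTI; exact: mf.
by apply/seteqP; split => x /=; rewrite in_itv/= andbT.
Qed.

Lemma bmf_sum (I : Type) (s : seq I) (F : I -> T -> R) :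
  (forall i, bmf (F i)) -> bmf (fun x => \sum_(i <- s) F i x).
Proof.
move=> bF; elim: s => [|i s IH].
  by under eq_fun do rewrite big_nil; exact: bmf_cst.
by under eq_fun do rewrite big_cons; exact: bmfD.
Qed.

Lemma bmf_le f K : measurable_fun setT f -> (forall x, `|f x| <= K) -> bmf f.
Proof. by move=> mf fK; split=> //; exists K. Qed.

End bounded_measurable.

Lemma bmf_comp d d' (T : measurableType d) (U : measurableType d')
    (R : realType) (f : U -> R) (X : T -> U) :
  measurable_fun setT X -> bmf f -> bmf (fun x => f (X x)).
Proof.
move=> mX [mf [K fK]]; split; first exact: measurableT_comp.
by exists K => x; exact: fK.
Qed.

Section mean.
Context d (T : measurableType d) (R : realType).
Variables (mu : {measure set T -> \bar R}) (mu1 : mu setT = 1%E).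
Implicit Types (f g : T -> R) (a : R).

Lemma bmf_integrable f : bmf f -> mu.-integrable setT (EFin \o f).
Proof.
move=> [mf [K fK]]; apply: measurable_bounded_integrable => //.
  by rewrite mu1 ltry.
exists K; split; first exact: num_real.
by move=> L KL x _; apply: le_trans (fK x) _; exact: ltW.
Qed.

Lemma meanD f g : bmf f -> bmf g ->
  \int[mu]_x (f x + g x) = \int[mu]_x f x + \int[mu]_x g x.
Proof. by move=> bf bg; rewrite RintegralD//; exact: bmf_integrable. Qed.

Lemma meanB f g : bmf f -> bmf g ->
  \int[mu]_x (f x - g x) = \int[mu]_x f x - \int[mu]_x g x.
Proof. by move=> bf bg; rewrite RintegralB//; exact: bmf_integrable. Qed.

Lemma meanZ a f : bmf f -> \int[mu]_x (a * f x) = a * \int[mu]_x f x.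
Proof. by move=> bf; rewrite RintegralZl//; exact: bmf_integrable. Qed.

Lemma mean_cst a : \int[mu]_x a = a.
Proof. by rewrite Rintegral_cst// mu1 mulr1. Qed.

Lemma mean_sum (I : Type) (s : seq I) (F : I -> T -> R) :
  (forall i, bmf (F i)) ->
  \int[mu]_x (\sum_(i <- s) F i x) = \sum_(i <- s) \int[mu]_x F i x.
Proof.
move=> bF; elim: s => [|i s IH].
  by under eq_Rintegral do rewrite big_nil; rewrite big_nil mean_cst.
under eq_Rintegral do rewrite big_cons.
by rewrite big_cons meanD ?IH//; exact: bmf_sum.
Qed.

Lemma le_mean f g : bmf f -> bmf g -> (forall x, f x <= g x) ->
  \int[mu]_x f x <= \int[mu]_x g x.
Proof. by move=> bf bg fg; rewrite le_Rintegral//; exact: bmf_integrable. Qed.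

Lemma norm_mean f : bmf f -> `|\int[mu]_x f x| <= \int[mu]_x `|f x|.
Proof. by move=> bf; rewrite le_normr_Rintegral//; exact: bmf_integrable. Qed.

Lemma norm_mean_le f g : bmf f -> bmf g -> (forall x, `|f x| <= g x) ->
  `|\int[mu]_x f x| <= \int[mu]_x g x.
Proof.
by move=> bf bg fg; rewrite (le_trans (norm_mean bf))// le_mean//; exact: bmf_norm.
Qed.

Lemma norm_mean_bound f a : bmf f -> (forall x, `|f x| <= a) ->
  `|\int[mu]_x f x| <= a.
Proof.
by move=> bf fa; rewrite -[leRHS]mean_cst norm_mean_le//; exact: bmf_cst.
Qed.

Lemma mean_indic (A : set T) : measurable A ->
  \int[mu]_x \1_A x = fine (mu A).
Proof. by move=> mA; rewrite /Rintegral integral_indic// setIT. Qed.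

End mean.

(** * Reduction to indicators *)

(** The number of integers k + 1 <= s with k < N is the integer part of s when
    0 <= s <= N; this form avoids integer parts. *)
Lemma count_below (R : realType) (s : R) (N : nat) : 0 <= s ->
  let c : nat -> R := fun N => \sum_(k <- iota 0 N) ((k.+1%:R <= s)%R : nat)%:R in
  [/\ c N <= s, (N%:R <= s -> c N = N%:R) & (s <= N%:R -> s <= c N + 1)].
Proof.
move=> s0 c; elim: N => [|N [cs cN cs1]]; rewrite /c.
  by rewrite big_nil; split => //; lra.
rewrite -[in iota _ _]addn1 iotaD big_cat [X in _ + X]/= big_seq1 add0n.
case: (leP N.+1%:R s) => Ns /=.
- have NS : N.+1%:R = N%:R + 1 :> R by rewrite -addn1 natrD.
  rewrite -/(c N) cN; last by move: Ns; rewrite NS; lra.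
  by rewrite -NS; split => //; lra.
- rewrite -/(c N) addr0; split; first by [].
  + by move: cs; lra.
  + move=> sN; case: (leP s N%:R) => [/cs1//|/ltW Ns'].
    by rewrite cN// -[X in _ + X]/(1%:R) -natrD addn1.
Qed.

Section layers.
Context d (T : measurableType d) (R : realType).

(** A bounded measurable function is a uniform limit of averages of indicators
    of its superlevel sets; so a bounded linear functional is controlled by its
    values on these sets. *)
Lemma functional_layers (L : (T -> R) -> R) (C c : R) (f : T -> R) :
  (forall f g, bmf f -> bmf g -> L (fun x => f x + g x) = L f + L g) ->
  (forall a f, bmf f -> L (fun x => a * f x) = a * L f) ->
  (forall f b, bmf f -> (forall x, `|f x| <= b) -> `|L f| <= C * b) ->
  measurable_fun setT f -> (forall x, 0 <= f x <= 1) ->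
  (forall a, `|L \1_[set x | a <= f x]| <= c) -> `|L f| <= c.
Proof.
move=> LD LZ Lb mf f01 Lc.
have blev a : bmf (\1_[set x | a <= f x] : T -> R).
  by apply: bmf_indic; exact: measurable_superlevel.
have bf : bmf f.
  by apply: (@bmf_le _ _ _ _ 1) => // x; rewrite ger0_norm; case/andP: (f01 x).
have Lsum (s : seq nat) (F : nat -> T -> R) : (forall i, bmf (F i)) ->
    L (fun x => \sum_(i <- s) F i x) = \sum_(i <- s) L (F i).
  move=> bF; elim: s => [|i s IH].
    under eq_fun do rewrite big_nil.
    rewrite big_nil; transitivity (0 * L (fun=> 0)); last by rewrite mul0r.
    by rewrite -LZ ?mul0r//; exact: bmf_cst.
  under eq_fun do rewrite big_cons.
  by rewrite big_cons LD ?IH//; exact: bmf_sum.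
have C0 : 0 <= C.
  have /= := @Lb _ 1 (bmf_cst T 0) (fun x => _); rewrite mulr1.
  by move=> H; apply: le_trans (H _) => // x; rewrite normr0.
apply/ler_addgt0Pr => e e0.
pose N := (Num.truncn (C / e)).+1.
have N0 : 0 < N%:R :> R by rewrite ltr0n.
have CN : C / N%:R <= e.
  rewrite ler_pdivrMr// mulrC -ler_pdivrMr//.
  by rewrite ltW// truncnS_gt.
pose fN x : R := N%:R^-1 * \sum_(k <- iota 0 N) \1_[set x | k.+1%:R / N%:R <= f x] x.
have bfN : bmf fN by apply: bmfZ; exact: bmf_sum.
(* For 0 <= f x <= 1, N * fN x is the integer part of N * f x. *)
have ffN x : `|f x - fN x| <= N%:R^-1.
  have /andP[f0 f1] := f01 x.
  have Nf0 : 0 <= N%:R * f x by rewrite mulr_ge0// ltW.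
  have [] := count_below N Nf0.
  set c0 := \sum_(k <- _) _ => c0s _ sc0.
  have -> : fN x = N%:R^-1 * c0.
    congr (_ * _); apply: eq_bigr => k _; rewrite indicE.
    by congr ((nat_of_bool _)%:R); apply/idP/idP; rewrite inE/= ler_pdivrMr// mulrC.
  have sc : N%:R * f x <= c0 + 1 by apply: sc0; rewrite ler_piMr// ltW.
  have h1 : N%:R^-1 * c0 <= f x by rewrite ler_pdivrMl.
  have h2 : f x <= N%:R^-1 * (c0 + 1) by rewrite ler_pdivlMl.
  have h3 : 0 < N%:R^-1 :> R by rewrite invr_gt0.
  by rewrite ler_norml; apply/andP; split; move: h2; rewrite mulrDr mulr1; lra.
have Lf : L f = L fN + L (fun x => f x - fN x).
  by rewrite -LD//; [congr L; apply/funext => x; rewrite subrKC|exact: bmfB].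
rewrite Lf (le_trans (ler_normD _ _))// lerD//; last first.
  by rewrite (le_trans _ CN)// Lb//; exact: bmfB.
rewrite LZ; last exact: bmf_sum.
rewrite Lsum// normrM (ger0_norm (ltW _)) ?invr_gt0// ler_pdivrMl//.
rewrite (le_trans (ler_norm_sum _ _ _))//.
rewrite (le_trans (ler_sum _ (fun k _ => Lc (k.+1%:R / N%:R))))//.
by rewrite big_const_seq count_predT size_iota iter_addr_0 mulr_natl.
Qed.

End layers.

Section layers_corollaries.
Context d (T : measurableType d) (R : realType).
Variables (L : (T -> R) -> R) (C : R).
Hypothesis LD :
  forall f g, bmf f -> bmf g -> L (fun x => f x + g x) = L f + L g.
Hypothesis LZ : forall a f, bmf f -> L (fun x => a * f x) = a * L f.
Hypothesis Lb :
  forall f b, bmf f -> (forall x, `|f x| <= b) -> `|L f| <= C * b.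

(** A functional that vanishes on superlevel sets vanishes; an equality of two
    integrals is reduced in this way to an equality of measures. *)
Lemma functional_vanish (f : T -> R) : bmf f ->
  (forall a, L \1_[set x | a <= f x] = 0) -> L f = 0.
Proof.
move=> bf L0; have [mf [K fK]] := bf.
have K0 : 0 <= K by rewrite (le_trans _ (fK point)).
have K1 : 0 < 2 * K + 1 by lra.
have L1 : L (fun=> 1) = 0.
  rewrite -(L0 (- K)); congr L; apply/funext => x; rewrite indicE mem_set//=.
  by have := fK x; rewrite ler_norml => /andP[].
(* The divisor 2 K + 1 brings the values into [0, 1] and is not 0 if K = 0. *)
pose g x := (2 * K + 1)^-1 * (f x + K).
have bfK : bmf (fun x => f x + K) by apply: bmfD => //; exact: bmf_cst.
have /normr0_eq0 Lg : `|L g| = 0.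
  apply/eqP; rewrite eq_le normr_ge0 andbT.
  apply: (functional_layers LD LZ Lb).
  - by apply: measurable_funM => //; exact: measurable_funD.
  - move=> x; have := fK x; rewrite ler_norml => /andP[f1 f2].
    by rewrite ler_pdivlMl// ler_pdivrMl//; apply/andP; split; lra.
  - move=> a; rewrite -[leRHS](normr0 R) -(L0 (a * (2 * K + 1) - K)).
    rewrite (_ : mkset _ = [set x | a * (2 * K + 1) - K <= f x])//.
    by apply/seteqP; split => x /=; rewrite /g ler_pdivlMl// => h; lra.
have : L g = (2 * K + 1)^-1 * (L f + K * L (fun=> 1)).
  rewrite LZ// LD//; last exact: bmf_cst.
  rewrite -LZ; last exact: bmf_cst.
  by congr (_ * (_ + L _)); apply/funext => x; rewrite mulr1.
rewrite Lg L1 mulr0 addr0 => /esym/eqP.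
by rewrite mulf_eq0 invr_eq0 gt_eqF//= => /eqP.
Qed.

(** The affine change (f + 1) / 2 maps values in [-1, 1] to [0, 1], which costs
    a factor 2. *)
Lemma functional_layers_sym (c : R) (f : T -> R) : L (fun=> 1) = 0 ->
  measurable_fun setT f -> (forall x, `|f x| <= 1) ->
  (forall A, measurable A -> `|L \1_A| <= c) -> `|L f| <= 2 * c.
Proof.
move=> L1 mf f1 Lc.
have bf : bmf f by exact: bmf_le f1.
pose g x := 2^-1 * (f x + 1).
have mg : measurable_fun setT g.
  by apply: measurable_funM => //; exact: measurable_funD.
have bfK : bmf (fun x => f x + 1) by apply: bmfD => //; exact: bmf_cst.
have Lg : `|L g| <= c.
  apply: (functional_layers LD LZ Lb) => //.
  - move=> x; have := f1 x; rewrite ler_norml => /andP[f2 f3].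
    by rewrite ler_pdivlMl// ler_pdivrMl//; apply/andP; split; lra.
  - by move=> a; apply: Lc; exact: measurable_superlevel.
have <- : 2 * L g = L f.
  by rewrite LZ// LD ?L1//; [rewrite addr0 mulrA divff ?mul1r|exact: bmf_cst].
by rewrite normrM ger0_norm// ler_pM2l.
Qed.

End layers_corollaries.

(** * Total variation and kernels *)

Section total_variation_mean.
Context d (T : measurableType d) (R : realType).
Variables (mu nu : {measure set T -> \bar R}).
Hypotheses (mu1 : mu setT = 1%E) (nu1 : nu setT = 1%E).

Lemma total_variation_mean (t : R) (f : T -> R) :
  (Defs.total_variation mu nu <= t%:E)%E ->
  measurable_fun setT f -> (forall x, `|f x| <= 1) ->
  `|\int[mu]_x f x - \int[nu]_x f x| <= 2 * t.
Proof.
move=> tv mf f1.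
apply: (@functional_layers_sym _ _ _
  (fun f => \int[mu]_x f x - \int[nu]_x f x) 2) => //.
- by move=> g h bg bh; rewrite !meanD//; ring.
- by move=> a g bg; rewrite !meanZ//; ring.
- move=> g b bg gb; rewrite (le_trans (ler_normB _ _))// mulr_natl mulr2n.
  by rewrite lerD//; exact: norm_mean_bound.
- by rewrite !mean_cst// subrr.
- move=> A mA; rewrite !mean_indic// -lee_fin.
  apply: le_trans tv; apply: ereal_sup_ubound; exists A => //.
  have fm (m : {measure set T -> \bar R}) : m setT = 1%E -> m A \is a fin_num.
    move=> m1; rewrite ge0_fin_numE// (@le_lt_trans _ _ (m setT))//.
      by rewrite le_measure ?inE.
    by rewrite m1 ltry.
  have -> : (mu A - nu A = (fine (mu A) - fine (nu A))%:E)%E.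
    by rewrite EFinB !fineK ?fm.
  by [].
Qed.

End total_variation_mean.

Definition kmean d (S : measurableType d) (R : realType) (K : R.-pker S ~> S)
  (f : S -> R) (x : S) : R := \int[K x]_y f y.

Section kernel_mean.
Context d (S : measurableType d) (R : realType).
Implicit Types (K P : R.-pker S ~> S) (f : S -> R).

Lemma kmean_bound K f a : bmf f -> (forall x, `|f x| <= a) ->
  forall x, `|kmean K f x| <= a.
Proof.
by move=> bf fa x; apply: norm_mean_bound => //; exact: prob_kernel.
Qed.

Lemma kmeanD K f g : bmf f -> bmf g ->
  kmean K (fun x => f x + g x) = fun x => kmean K f x + kmean K g x.
Proof.
by move=> bf bg; apply/funext => x; rewrite /kmean meanD//; exact: prob_kernel.
Qed.

Lemma kmeanZ K a f : bmf f ->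
  kmean K (fun x => a * f x) = fun x => a * kmean K f x.
Proof.
by move=> bf; apply/funext => x; rewrite /kmean meanZ//; exact: prob_kernel.
Qed.

Lemma bmf_kmean K f : bmf f -> bmf (kmean K f).
Proof.
move=> bf; have [mf [a fa]] := bf; split; last first.
  by exists a; exact: kmean_bound.
have a0 : 0 <= a by rewrite (le_trans _ (fa point)).
rewrite (_ : kmean K f = fun x => \int[K x]_y (f y + a) - a); last first.
  apply/funext => x; rewrite meanD//; [|exact: prob_kernel|exact: bmf_cst].
  by rewrite mean_cst ?addrK//; exact: prob_kernel.
apply: measurable_funB => //.
rewrite (_ : (fun _ => _) =
  fine \o (fun x => \int[K x]_y (f y + a)%:E)%E)//.
apply: measurableT_comp => //; apply: measurable_fun_integral_kernel => //.
- by move=> U mU; exact: measurable_kernel.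
- by move=> x; rewrite lee_fin; have := fa x; rewrite ler_norml => /andP[]; lra.
- by apply/measurable_EFinP; exact: measurable_funD.
Qed.

Lemma kmean_indic K (A : set S) x : measurable A ->
  kmean K \1_A x = fine (K x A).
Proof. exact: mean_indic. Qed.

Lemma fin_kernel K x (A : set S) : measurable A -> K x A \is a fin_num.
Proof.
move=> mA; rewrite ge0_fin_numE// (@le_lt_trans _ _ (K x setT))//.
  by rewrite le_measure ?inE.
by rewrite prob_kernel ltry.
Qed.

Lemma kmean_nstep0 P f : bmf f -> kmean (nstep P 0) f = f.
Proof.
move=> [mf _]; apply/funext => x; rewrite /kmean /Rintegral/=.
by rewrite integral_dirac ?diracT ?mul1e//; exact/measurable_EFinP.
Qed.

(** The Chapman-Kolmogorov equation for functions. *)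
Lemma kmean_nstepS P n f : bmf f ->
  kmean (nstep P n.+1) f = kmean P (kmean (nstep P n) f).
Proof.
move=> bf; apply/funext => x; apply/eqP; rewrite -subr_eq0; apply/eqP.
have P1 K z : K z setT = 1%E by exact: prob_kernel.
apply: (@functional_vanish _ _ _
  (fun f => kmean (nstep P n.+1) f x - kmean P (kmean (nstep P n) f) x) 2) => //.
- by move=> g h bg bh; rewrite !kmeanD//; [ring|exact: bmf_kmean..].
- by move=> a g bg; rewrite !kmeanZ//; [ring|exact: bmf_kmean].
- move=> g b bg gb; rewrite (le_trans (ler_normB _ _))// mulr_natl mulr2n.
  rewrite lerD//; first exact: kmean_bound.
  by apply: kmean_bound; [exact: bmf_kmean|exact: kmean_bound].
- move=> a; have [mf _] := bf.
  have := measurable_superlevel a mf.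
  set A := mkset _ => mA.
  rewrite kmean_indic// /kmean /Rintegral/=.
  rewrite (_ : mkcomp_noparam _ _ _ _ = \int[P x]_y nstep P n y A)%E//.
  rewrite (eq_integral (fun y => (\int[nstep P n y]_z \1_A z)%:E)) ?subrr//.
  by move=> y _; rewrite mean_indic// fineK// fin_kernel.
Qed.

End kernel_mean.

(** * The Markov property for bounded functionals of the past *)

Section past.
Context dO (Omega : measurableType dO) d (S : measurableType d) (R : realType).
Variable Pr : probability Omega R.
Variable X : nat -> {RV Pr >-> S}.

Definition past_events (n : nat) : set (set Omega) :=
  \bigcup_(i in [set i | (i <= n)%N])
     preimage_set_system setT (X i) measurable.

(** The sample space with the sigma-algebra of X_0, ..., X_n, so that closure
    properties of functions of the past are instances of those of measurable
    functions. *)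
Definition past_space (n : nat) := g_sigma_algebraType (past_events n).

Definition past (n : nat) (Z : Omega -> R) : Prop :=
  measurable_fun [set: past_space n] (Z : past_space n -> R) /\
  exists K, forall w, `|Z w| <= K.

Lemma sub_history n E : history X n E -> measurable E.
Proof.
apply: smallest_sub; first exact: sigma_algebra_measurable.
by move=> _ [i _ [B mB <-]]; rewrite setTI; exact: measurable_funPTI.
Qed.

Lemma past_bmf n Z : past n Z -> bmf Z.
Proof.
move=> [mZ bZ]; split => // _ B mB; apply: (@sub_history n).
exact: mZ.
Qed.

Lemma past_level n Z a : past n Z -> history X n [set w | a <= Z w].
Proof.
move=> [mZ _]; rewrite (_ : mkset _ = setT `&` Z @^-1` `[a, +oo[%classic).
  exact: mZ.
by apply/seteqP; split => w /=; rewrite in_itv/= andbT//; case.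
Qed.

Lemma history_mono n k : (n <= k)%N -> history X n `<=` history X k.
Proof.
move=> nk; apply: sub_sigma_algebra2 => E [i/= ik h]; exists i => //=.
exact: leq_trans nk.
Qed.

Lemma past_mono n k Z : (n <= k)%N -> past n Z -> past k Z.
Proof.
move=> nk [mZ bZ]; split => // _ B mB; apply: (history_mono nk).
exact: mZ.
Qed.

Lemma past_at n k (h : S -> R) : (k <= n)%N -> bmf h -> past n (fun w => h (X k w)).
Proof.
move=> kn [mh [K hK]]; split; last by exists K => w; exact: hK.
move=> _ B mB; apply: sub_sigma_algebra; exists k => //=.
exists (h @^-1` B) => //; rewrite -[X in measurable X]setTI; exact: mh.
Qed.

Lemma pastM n Z W : past n Z -> past n W -> past n (fun w => Z w * W w).
Proof. exact: (@bmfM _ (past_space n)). Qed.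

Lemma past_cst n a : past n (fun=> a).
Proof. exact: (@bmf_cst _ (past_space n)). Qed.

Lemma pastZ n a Z : past n Z -> past n (fun w => a * Z w).
Proof. exact: (@bmfZ _ (past_space n)). Qed.

Lemma past_sum n (s : seq nat) (F : nat -> Omega -> R) :
  (forall i, past n (F i)) -> past n (fun w => \sum_(i <- s) F i w).
Proof. exact: (@bmf_sum _ (past_space n)). Qed.

Lemma past_comp n (u : R -> R) Z : measurable_fun setT u ->
  (exists K, forall x, `|u x| <= K) -> past n Z -> past n (fun w => u (Z w)).
Proof.
move=> mu [K uK] [mZ _]; split; last by exists K => w; exact: uK.
exact: measurableT_comp.
Qed.

End past.

Section markov_property.
Context dO (Omega : measurableType dO) d (S : measurableType d) (R : realType).
Variable Pr : probability Omega R.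
Variable X : nat -> {RV Pr >-> S}.
Variable P : R.-pker S ~> S.
Hypothesis XP : markov_chain P X.

Let Pr1 : Pr setT = 1%E. Proof. exact: probability_setT. Qed.

Let bmf_X n (f : S -> R) : bmf f -> bmf (fun w => f (X n w)).
Proof. by move=> bf; exact: bmf_comp. Qed.

(** For an event of the past, both sides are linear in f, and they agree on
    indicators by definition of a Markov chain. *)
Lemma markov_event n E (f : S -> R) : history X n E -> bmf f ->
  \int[Pr]_w (\1_E w * f (X n.+1 w)) = \int[Pr]_w (\1_E w * kmean P f (X n w)).
Proof.
move=> hE bf; have mE := sub_history hE.
have b1 (g : S -> R) k : bmf g -> bmf (fun w => \1_E w * g (X k w)).
  by move=> bg; apply: bmfM; [exact: bmf_indic|exact: bmf_X].
have P1 z : P z setT = 1%E by exact: prob_kernel.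
apply/eqP; rewrite -subr_eq0; apply/eqP.
pose L f := \int[Pr]_w (\1_E w * f (X n.+1 w)) -
  \int[Pr]_w (\1_E w * kmean P f (X n w)).
apply: (@functional_vanish _ _ _ L 2) => //.
- move=> g h bg bh; rewrite /L.
  under eq_Rintegral do rewrite mulrDr.
  rewrite meanD//; [|exact: b1..].
  rewrite kmeanD//; under [X in _ - X]eq_Rintegral do rewrite mulrDr.
  by rewrite [X in _ - X]meanD//; [ring|apply: b1; exact: bmf_kmean..].
- move=> a g bg; rewrite /L.
  under eq_Rintegral do rewrite mulrCA.
  rewrite meanZ//; last exact: b1.
  rewrite kmeanZ//; under [X in _ - X]eq_Rintegral do rewrite mulrCA.
  by rewrite [X in _ - X]meanZ//; [ring|apply: b1; exact: bmf_kmean].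
- have E1 (a b : R) w : `|a| <= b -> `|\1_E w * a| <= b :> R.
    rewrite indicE; case: (_ \in _); rewrite ?mul1r// mul0r normr0.
    exact: le_trans.
  move=> g b bg gb; rewrite (le_trans (ler_normB _ _))// mulr_natl mulr2n.
  rewrite lerD//; apply: norm_mean_bound => //; try by apply: b1 => //; exact: bmf_kmean.
  + by move=> w; exact: E1.
  + by move=> w; apply: E1; exact: kmean_bound.
- move=> a; have [mf _] := bf.
  have := measurable_superlevel a mf.
  set A := mkset _ => mA.
  apply/eqP; rewrite subr_eq0; apply/eqP.
  transitivity (fine (Pr (E `&` X n.+1 @^-1` A))).
    rewrite -mean_indic//; last by apply: measurableI => //; exact: measurable_funPTI.
    by apply: eq_Rintegral => w _; rewrite indicI.
  rewrite XP// [RHS]/Rintegral [in LHS]integral_mkcond; congr fine.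
  apply: eq_integral => w _; rewrite patchE indicE.
  case: (_ \in _); rewrite ?mul0r// mul1r.
  by rewrite kmean_indic// fineK// fin_kernel.
Qed.

(** The superlevel sets of Z are events of the past, so the layers of Z reduce
    the Markov property to the previous lemma. *)
Lemma markov_step n Z (f : S -> R) : past X n Z -> bmf f ->
  \int[Pr]_w (Z w * f (X n.+1 w)) = \int[Pr]_w (Z w * kmean P f (X n w)).
Proof.
move=> pZ bf; have bZ := past_bmf pZ.
have bPf : bmf (kmean P f) by exact: bmf_kmean.
have [mf [K fK]] := bf.
apply/eqP; rewrite -subr_eq0; apply/eqP.
have b1 (g : S -> R) k (W : Omega -> R) : bmf g -> bmf W -> bmf (fun w => W w * g (X k w)).
  by move=> bg bW; apply: bmfM => //; exact: bmf_X.
apply: (@functional_vanish _ _ _ (fun Z => \int[Pr]_w (Z w * f (X n.+1 w)) -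
  \int[Pr]_w (Z w * kmean P f (X n w))) (2 * K)) => //.
- move=> g h bg bh.
  under eq_Rintegral do rewrite mulrDl.
  under [X in _ - X]eq_Rintegral do rewrite mulrDl.
  by rewrite !meanD//; [ring|exact: b1..].
- move=> a g bg.
  under eq_Rintegral do rewrite -mulrA.
  under [X in _ - X]eq_Rintegral do rewrite -mulrA.
  by rewrite !meanZ//; [ring|exact: b1..].
- move=> g b bg gb; rewrite (le_trans (ler_normB _ _))// mulr_natl mulr2n mulrDl.
  rewrite lerD//; apply: norm_mean_bound => //; try by apply: b1.
  + by move=> w; rewrite normrM mulrC ler_pM.
  + by move=> w; rewrite normrM mulrC ler_pM// kmean_bound.
- move=> a; apply/eqP; rewrite subr_eq0; apply/eqP.
  by apply: markov_event => //; exact: past_level.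
Qed.

Lemma markov_nstep n k Z (f : S -> R) : past X n Z -> bmf f ->
  \int[Pr]_w (Z w * f (X (n + k)%N w)) =
  \int[Pr]_w (Z w * kmean (nstep P k) f (X n w)).
Proof.
elim: k n => [|k IH] n pZ bf; first by rewrite addn0 kmean_nstep0.
rewrite addnS -addSn IH//; last exact: past_mono pZ.
rewrite kmean_nstepS// markov_step//; exact: bmf_kmean.
Qed.

End markov_property.

Section invariance.
Context d (S : measurableType d) (R : realType).
Variables (P : R.-pker S ~> S) (pi : probability S R).
Hypothesis Ppi : invariant_distribution P pi.

Lemma mean_invariant (f : S -> R) : bmf f -> \int[pi]_x kmean P f x = \int[pi]_x f x.
Proof.
move=> bf; have [mf _] := bf.
have pi1 : pi setT = 1%E by exact: probability_setT.
have P1 z : P z setT = 1%E by exact: prob_kernel.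
apply/eqP; rewrite -subr_eq0; apply/eqP.
apply: (@functional_vanish _ _ _
  (fun f => \int[pi]_x kmean P f x - \int[pi]_x f x) 2) => //.
- by move=> g h bg bh; rewrite kmeanD// !meanD//; [ring|exact: bmf_kmean..].
- by move=> a g bg; rewrite kmeanZ// !meanZ//; [ring|exact: bmf_kmean].
- move=> g b bg gb; rewrite (le_trans (ler_normB _ _))// mulr_natl mulr2n.
  rewrite lerD//; apply: norm_mean_bound => //; first exact: bmf_kmean.
  exact: kmean_bound.
- move=> a.
  have := measurable_superlevel a mf.
  set A := mkset _ => mA.
  rewrite [X in _ - X](mean_indic _ mA).
  have -> : \int[pi]_x kmean P \1_A x = fine (\int[pi]_x P x A)%E.
    congr fine; apply: eq_integral => x _.
    by rewrite kmean_indic// fineK// fin_kernel.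
  by rewrite Ppi// subrr.
Qed.

Lemma mean_invariant_nstep n (f : S -> R) : bmf f ->
  \int[pi]_x kmean (nstep P n) f x = \int[pi]_x f x.
Proof.
move=> bf; elim: n => [|n IH]; first by rewrite kmean_nstep0.
by rewrite kmean_nstepS// mean_invariant//; exact: bmf_kmean.
Qed.

End invariance.

(** * Polynomial decay *)

Lemma big_nat_backward (V : nmodType) (F : nat -> V) (t L : nat) :
  \sum_(t <= i < t + L) F i = \sum_(1 <= k < L.+1) F (t + L - k)%N.
Proof.
elim: L => [|L IH]; first by rewrite addn0 !big_geq.
rewrite addnS big_nat_recr ?leq_addr//= big_nat_recl//= IH addrC subn1 /=.
by congr (_ + _); apply: eq_bigr => k _; rewrite ?addnS subSS.
Qed.

Section power_sums.
Context (R : realType) (m : R) (m1 : 1 < m).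

Lemma powRN_nincr (k l : nat) : (0 < k)%N -> (k <= l)%N ->
  l%:R `^ (- m) <= k%:R `^ (- m) :> R.
Proof.
move=> k0 kl; rewrite !powRN lef_pV2 ?posrE ?powR_gt0 ?ltr0n//; last first.
  exact: leq_trans kl.
by rewrite ge0_ler_powR ?nnegrE// ?ler_nat// ltW// (lt_trans _ m1).
Qed.

(** Pairing the indices 2k and 2k+1 bounds the sum up to 2N by 1 plus the
    fraction 2^(1-m) < 1 of the sum up to N. *)
Lemma power_sum_bounded :
  exists2 C : R, 0 <= C & forall N, \sum_(1 <= k < N) k%:R `^ (- m) <= C.
Proof.
pose q : R := 2 * 2 `^ (- m).
have q1 : q < 1.
  rewrite /q powRN ltr_pdivrMr ?powR_gt0// mul1r.
  rewrite -(@mulr_powRB1 _ 2 m)//; last exact: lt_trans m1.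
  rewrite ltr_pMr// -[ltLHS](congr1 (fun f => f (m - 1)) (powR1 R)).
  by rewrite gt0_ltr_powR ?nnegrE// ?subr_gt0// ltr1n.
have q0 : 0 <= q by rewrite mulr_ge0// powR_ge0.
have dbl N : \sum_(1 <= k < N.*2) k%:R `^ (- m) <=
    1 + q * \sum_(1 <= k < N) k%:R `^ (- m) :> R.
  elim: N => [|[|N] IH].
  - by rewrite !big_geq// mulr0 addr0.
  - by rewrite big_nat1 big_geq// mulr0 addr0 powR1.
  - rewrite doubleS [X in X <= _]big_nat_recr// [X in X + _ <= _]big_nat_recr//.
    rewrite [X in _ * X]big_nat_recr// mulrDr addrA.
    have N0 : (0 < N.+1.*2)%N by [].
    have h := powRN_nincr N0 (leqnSn _).
    have e : q * N.+1%:R `^ (- m) = 2 * N.+1.*2%:R `^ (- m).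
      by rewrite /q -mul2n natrM powRM// mulrA.
    apply: le_trans (lerD (lerD IH (lexx _)) h) _.
    by rewrite e mulr_natl mulr2n !addrA.
exists (1 - q)^-1; first by rewrite invr_ge0; lra.
move=> N; rewrite -[leRHS]mul1r ler_pdivlMr; last by lra.
have : \sum_(1 <= k < N) k%:R `^ (- m) <= \sum_(1 <= k < N.*2) k%:R `^ (- m) :> R.
  have [->|N0] := posnP N; first by [].
  rewrite [leRHS](@big_cat_nat _ _ _ N)//=; last by rewrite -addnn leq_addr.
  by rewrite lerDl sumr_ge0// => i _; exact: powR_ge0.
by have := dbl N; lra.
Qed.

End power_sums.

(** * Mixing *)

Section mixing.
Context dO (Omega : measurableType dO) d (S : measurableType d) (R : realType).
Variable Pr : probability Omega R.
Variable X : nat -> {RV Pr >-> S}.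
Variables (P : R.-pker S ~> S) (pi : probability S R).
Hypothesis XP : markov_chain P X.
Variables (M : S -> R) (m : R).
Hypotheses (mM : measurable_fun setT M) (M0 : forall x, 0 <= M x).
Hypothesis iM : (\int[pi]_x (M x)%:E < +oo)%E.
Hypothesis TVM : forall (x : S) (n : nat), (0 < n)%N ->
  (Defs.total_variation (nstep P n x) pi <= (M x * n%:R `^ (- m))%:E)%E.

Let Pr1 : Pr setT = 1%E. Proof. exact: probability_setT. Qed.
Let pi1 : pi setT = 1%E. Proof. exact: probability_setT. Qed.

Let r (k : nat) : R := k%:R `^ (- m).
Let r0 k : 0 <= r k. Proof. exact: powR_ge0. Qed.

(** The truncation at 1 keeps this function bounded when the rate M is not. *)
Definition distance_bound (k : nat) (x : S) : R := Num.min 1 (M x * k%:R `^ (- m)).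

Lemma distance_bound_ge0 k x : 0 <= distance_bound k x.
Proof. by rewrite le_min ler01 mulr_ge0. Qed.

Lemma bmf_distance_bound k : bmf (distance_bound k).
Proof.
apply: (@bmf_le _ _ _ _ 1).
  by apply: measurable_minr => //; exact: measurable_funM.
by move=> x; rewrite ger0_norm ?distance_bound_ge0// ge_min lexx.
Qed.

Lemma nstep_mean_dist k x (H : S -> R) : (0 < k)%N ->
  measurable_fun setT H -> (forall y, `|H y| <= 1) ->
  `|kmean (nstep P k) H x - \int[pi]_y H y| <= 2 * distance_bound k x.
Proof.
move=> k0 mH H1; have bH : bmf H by exact: bmf_le H1.
have K1 : nstep P k x setT = 1%E by exact: prob_kernel.
rewrite /distance_bound; case: (leP 1 (M x * k%:R `^ (- m))) => _.
  rewrite mulr1 (le_trans (ler_normB _ _))// -[2]/(1 + 1).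
  by rewrite lerD//; exact: norm_mean_bound.
by apply: total_variation_mean => //; exact: TVM.
Qed.

Definition mean_rate : R := \int[pi]_x M x.

Let integrableM : pi.-integrable setT (EFin \o M).
Proof.
apply/integrableP; split; first exact/measurable_EFinP.
by under eq_integral do rewrite /= ger0_norm//.
Qed.

Lemma mean_rate_ge0 : 0 <= mean_rate.
Proof. exact: Rintegral_ge0. Qed.

Lemma mean_distance_bound k :
  \int[pi]_x distance_bound k x <= mean_rate * k%:R `^ (- m).
Proof.
rewrite /mean_rate -RintegralZr//; apply: le_Rintegral => //.
- by apply: bmf_integrable => //; exact: bmf_distance_bound.
- have := integrableZl measurableT (r k) integrableM.
  by apply: eq_integrable => // x _; rewrite /= mulrC EFinM.
- by move=> x _; rewrite ge_min lexx orbT.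
Qed.

Variable K : R.
Hypothesis K0 : 0 <= K.

(** M (X 0) need not be integrable: the expectations below carry the indicator
    of this event, on which the law of X_t is at distance at most K t^(-m) from
    pi. *)
Definition small_start : set Omega := X 0%N @^-1` [set x | M x <= K].

Let e (w : Omega) : R := \1_small_start w.

Lemma measurable_small_start : measurable small_start.
Proof.
have -> : small_start = X 0%N @^-1` (M @^-1` `]-oo, K]%classic).
  by apply/seteqP; split => w /=; rewrite in_itv.
apply: measurable_funPTI; rewrite -[X in measurable X]setTI; exact: mM.
Qed.

Lemma past_small_start n : past X n e.
Proof.
apply: (@past_at _ _ _ _ _ _ _ n 0%N (\1_[set x | M x <= K])) => //.
apply: bmf_indic; rewrite (_ : mkset _ = (M @^-1` `]-oo, K]%classic)).
  by rewrite -[X in measurable X]setTI; exact: mM.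
by apply/seteqP; split => w /=; rewrite in_itv.
Qed.

Let be : bmf e. Proof. exact: past_bmf (past_small_start 0). Qed.
Let e0 w : 0 <= e w. Proof. by rewrite /e indicE. Qed.
Let e1 w : e w <= 1.
Proof. by rewrite /e indicE; case: (_ \in _). Qed.

Let bX n (f : S -> R) : bmf f -> bmf (fun w => f (X n w)).
Proof. by move=> bf; exact: bmf_comp. Qed.

(** By the Markov property from time 0, the mean under the law of X_t exceeds
    the mean under pi by at most twice K t^(-m). *)
Lemma mean_distance_start t k : (0 < t)%N ->
  \int[Pr]_w (e w * distance_bound k (X t w)) <=
  mean_rate * r k + 2 * K * r t.
Proof.
move=> t0; have bb := bmf_distance_bound k.
rewrite -[t]add0n (markov_nstep XP _ (past_small_start 0) bb).
rewrite -[leRHS](mean_cst Pr1) le_mean//.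
- by apply: bmfM => //; apply: bX; exact: bmf_kmean.
- exact: bmf_cst.
move=> w; rewrite add0n /e indicE; case: (boolP (w \in small_start)); last first.
  by rewrite mul0r addr_ge0// mulr_ge0// ?mean_rate_ge0// mulr_ge0.
rewrite inE /= => MK; rewrite mul1r.
have b1 y : `|distance_bound k y| <= 1.
  by rewrite ger0_norm ?distance_bound_ge0// ge_min lexx.
have := nstep_mean_dist (X 0%N w) t0 (bb.1) b1.
rewrite ler_norml => /andP[_].
have := mean_distance_bound k; rewrite -/(r k).
have : distance_bound t (X 0%N w) <= K * r t.
  by rewrite ge_min; apply/orP; right; rewrite ler_wpM2r.
lra.
Qed.

Definition mixing_constant : R := 2 * mean_rate + 4 * K.

Lemma mixing_constant_ge0 : 0 <= mixing_constant.
Proof. by have := mean_rate_ge0; rewrite /mixing_constant; have := K0; lra. Qed.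

Local Notation D := mixing_constant.

(** Conditionally on the past at time t, the mean of H (X (t + k)) is that of
    P^k H at X t, which is close to the mean under pi. *)
Lemma mixing t k (a : R) (Z : Omega -> R) (H : S -> R) :
  (0 < t)%N -> (0 < k)%N -> past X t Z -> 0 <= a ->
  (forall w, `|Z w| <= a * e w) ->
  measurable_fun setT H -> (forall x, `|H x| <= 1) ->
  `|\int[Pr]_w (Z w * H (X (t + k)%N w)) - (\int[Pr]_w Z w) * \int[pi]_x H x|
    <= a * (D * (r k + r t)).
Proof.
move=> t0 k0 pZ a0 Za mH H1.
have bH : bmf H by exact: bmf_le H1.
have bZ := past_bmf pZ; have bb := bmf_distance_bound k.
have bK : bmf (kmean (nstep P k) H) by exact: bmf_kmean.
rewrite (markov_nstep XP _ pZ bH) [in X in _ - X]mulrC -(meanZ Pr1)// -(meanB Pr1); last 2 first.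
- by apply: bmfM => //; exact: bX.
- exact: bmfZ.
have bed : bmf (fun w => e w * distance_bound k (X t w)).
  by apply: bmfM => //; exact: bX.
apply: (@le_trans _ _ (\int[Pr]_w ((2 * a) * (e w * distance_bound k (X t w))))).
  apply: norm_mean_le => //.
  - by apply: bmfB; [apply: bmfM => //; exact: bX|exact: bmfZ].
  - exact: bmfZ.
  - move=> w; rewrite [X in _ - X]mulrC -mulrBr normrM.
    rewrite (_ : 2 * a * _ = (a * e w) * (2 * distance_bound k (X t w))); last by ring.
    by rewrite ler_pM// nstep_mean_dist.
rewrite (meanZ Pr1)// -mulrA mulrCA ler_wpM2l//.
have := mean_distance_start k t0; rewrite /D.
have := mulr_ge0 mean_rate_ge0 (r0 t); have := mulr_ge0 K0 (r0 k).
by have := r0 k; have := r0 t; move: (\int[Pr]_w _) => I; nra.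
Qed.

Variable h : S -> R.
Hypotheses (mh : measurable_fun setT h) (h1 : forall x, `|h x| <= 1).
Hypothesis pih : \int[pi]_x h x = 0.

Let bh : bmf h. Proof. exact: bmf_le h1. Qed.

(** For centred h, the covariance of h (X 0) and h (X k) for the stationary
    chain. *)
Definition autocov (k : nat) : R := \int[pi]_x (h x * kmean (nstep P k) h x).

Lemma autocov_bound k : (0 < k)%N ->
  `|autocov k| <= 2 * mean_rate * k%:R `^ (- m).
Proof.
move=> k0; have bK : bmf (kmean (nstep P k) h) by exact: bmf_kmean.
have bb := bmf_distance_bound k.
apply: (@le_trans _ _ (\int[pi]_x (2 * distance_bound k x))).
  apply: norm_mean_le => //; [exact: bmfM|exact: bmfZ|move=> x].
  rewrite normrM -[leRHS]mul1r ler_pM//.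
  by have := nstep_mean_dist x k0 mh h1; rewrite pih subr0.
by rewrite meanZ// -mulrA ler_pM2l// mean_distance_bound.
Qed.

(** The later factor is first averaged given the past at time t + j, so that
    the pair becomes the function h * P^k h of X (t + j), to which mixing
    applies. *)
Lemma mixing_pair t j k (a : R) (Z : Omega -> R) :
  (0 < t)%N -> (0 < j)%N -> past X t Z -> 0 <= a ->
  (forall w, `|Z w| <= a * e w) ->
  `|\int[Pr]_w (Z w * h (X (t + j)%N w) * h (X (t + j + k)%N w))
    - (\int[Pr]_w Z w) * autocov k| <= a * (D * (r j + r t)).
Proof.
move=> t0 j0 pZ a0 Za.
have pZh : past X (t + j) (fun w => Z w * h (X (t + j)%N w)).
  by apply: pastM; [exact: past_mono (leq_addr _ _) pZ|exact: past_at].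
rewrite (markov_nstep XP k pZh bh).
under eq_Rintegral do rewrite -mulrA.
have bK : bmf (kmean (nstep P k) h) by exact: bmf_kmean.
apply: (@mixing t j a Z (fun x => h x * kmean (nstep P k) h x)) => //.
  exact: (bmfM bh bK).1.
by move=> x; rewrite normrM mulr_ile1// kmean_bound.
Qed.

(** Adding a term to the window adds its covariances with the earlier terms, of
    which the part k^(-m) at lag k is summable, and the part due to the start is
    at most l^(-m) each, as the window begins after time l. *)
Lemma window_second_moment (C : R) (l t L : nat) :
  1 < m -> (forall N, \sum_(1 <= k < N) r k <= C) ->
  (0 < l)%N -> (l <= t)%N ->
  \int[Pr]_w (e w * (\sum_(t <= i < t + L) h (X i w)) ^+ 2) <=
  L%:R * (1 + 2 * D * (C + L%:R * r l)).
Proof.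
move=> m1 rC l0 lt; have D0 := mixing_constant_ge0.
have C0 : 0 <= C by have := rC 0%N; rewrite big_geq.
have bhX i : bmf (fun w => h (X i w)) by exact: bX.
pose W L w : R := \sum_(t <= i < t + L) h (X i w).
have bW L' : bmf (W L') by exact: bmf_sum.
have step L' : \int[Pr]_w (e w * W L'.+1 w ^+ 2) <=
    \int[Pr]_w (e w * W L' w ^+ 2) + (1 + 2 * D * (C + L'%:R * r l)).
  pose c i w := e w * h (X i w) * h (X (t + L')%N w).
  have bc i : bmf (c i) by apply: bmfM => //; exact: bmfM.
  have bW2 L2 : bmf (fun w => e w * W L2 w ^+ 2).
    by apply: bmfM => //; under eq_fun do rewrite expr2; exact: bmfM.
  have WS w : W L'.+1 w = W L' w + h (X (t + L')%N w).
    by rewrite /W addnS big_nat_recr//= leq_addr.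
  apply: (@le_trans _ _ (\int[Pr]_w (e w * W L' w ^+ 2 +
      (2 * \sum_(t <= i < t + L') c i w + 1)))).
    apply: le_mean => //.
      apply: bmfD => //; apply: bmfD; last exact: bmf_cst.
      by apply: bmfZ; exact: bmf_sum.
    move=> w; rewrite WS.
    have -> : \sum_(t <= i < t + L') c i w = e w * (W L' w * h (X (t + L')%N w)).
      by rewrite /W mulr_suml mulr_sumr; apply: eq_bigr => i _; rewrite /c mulrA.
    have : e w * h (X (t + L')%N w) ^+ 2 <= 1.
      rewrite mulr_ile1// ?sqr_ge0// -real_normK ?num_real//.
      by rewrite exprn_ile1.
    by set a := W _ _; set b := h _; nra.
  rewrite !(meanD Pr1)//; last 3 first.
  - by apply: bmfZ; exact: bmf_sum.
  - exact: bmf_cst.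
  - apply: bmfD; last exact: bmf_cst.
    by apply: bmfZ; exact: bmf_sum.
  rewrite lerD2l mean_cst// addrC lerD2l (meanZ Pr1); last exact: bmf_sum.
  rewrite -mulrA ler_pM2l// (mean_sum Pr1)//.
  apply: (@le_trans _ _ (\sum_(t <= i < t + L') D * (r (t + L' - i) + r l))).
    rewrite big_nat [leRHS]big_nat ler_sum// => i /andP[ti iL].
    have i0 : (0 < i)%N by rewrite (leq_trans l0)// (leq_trans lt).
    have gap0 : (0 < t + L' - i)%N by rewrite subn_gt0.
    have pc : past X i (fun w => e w * h (X i w)).
      by apply: pastM; [exact: past_small_start|exact: past_at].
    have := @mixing i (t + L' - i)%N 1 _ h i0 gap0 pc ler01 _ mh h1.
    rewrite subnKC; last exact: ltnW.
    rewrite pih mulr0 subr0 mul1r => /(_ _) H.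
    apply: le_trans (ler_norm _) _; apply: le_trans (H _) _.
      by move=> w; rewrite mul1r normrM ger0_norm// ler_piMr.
    rewrite ler_wpM2l// lerD2l; apply: powRN_nincr => //.
    exact: leq_trans ti.
  rewrite -mulr_sumr ler_wpM2l// big_split/= lerD//.
    rewrite big_nat_backward (le_trans _ (rC L'.+1))// big_nat [leRHS]big_nat.
    rewrite ler_sum// => k /andP[_ kL]; rewrite subKn//.
    by apply: leq_trans (leq_addl t L').

  by rewrite big_const_nat iter_addr_0 addKn mulr_natl.
have : forall L', (L' <= L)%N -> \int[Pr]_w (e w * W L' w ^+ 2) <=
    L'%:R * (1 + 2 * D * (C + L%:R * r l)).
  elim=> [_|L' IH L'L].
    rewrite mul0r (eq_Rintegral _ (g := cst 0)) ?mean_cst// => w _.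
    by rewrite /W addn0 big_geq// expr0n/= mulr0.
  rewrite -addn1 natrD mulrDl mul1r addn1.
  apply: le_trans (step L') _; rewrite lerD// ?IH 1?ltnW//.
  rewrite lerD2l ler_wpM2l ?mulr_ge0// lerD2l ler_wpM2r// ler_nat.
  exact: ltnW.
by apply.
Qed.

End mixing.

(** * The Lindeberg argument *)

(** A test function U v x, with its first two derivatives U1 and U2 in x, to
    which the heat flow applies: U v + (s / 2) U2 v is U (v + s) up to a quadratic
    error.  K bounds all the derivatives needed for v >= v0.  The Taylor expansion
    is that of the increment from a + b to a + b + z, with derivatives taken at
    a. *)
Record heat_test (R : realType) (v0 K : R) (U U1 U2 : R -> R -> R) : Prop :=
  HeatTest {
    heat_test_measurable : forall v, [/\ measurable_fun setT (U v),
      measurable_fun setT (U1 v) & measurable_fun setT (U2 v)];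
    heat_test_bounded : forall v x, v0 <= v ->
      [/\ `|U v x| <= K, `|U1 v x| <= K & `|U2 v x| <= K];
    heat_test_lipschitz : forall v x y, v0 <= v ->
      `|U v x - U v y| <= K * `|x - y|;
    heat_test_lipschitz2 : forall v x y, v0 <= v ->
      `|U2 v x - U2 v y| <= K * `|x - y|;
    heat_test_heat : forall v s x, v0 <= v -> 0 <= s ->
      `|U (v + s) x - U v x - s / 2 * U2 v x| <= K * s ^+ 2;
    heat_test_taylor : forall v a b z, v0 <= v ->
      `|U v (a + b + z) - U v (a + b) - U1 v a * z
        - U2 v a * (b * z + z ^+ 2 / 2)| <= K * ((`|b| + `|z|) ^+ 2 * `|z|)
  }.

Section lindeberg.
Context dO (Omega : measurableType dO) d (S : measurableType d) (R : realType).
Variable Pr : probability Omega R.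
Variable X : nat -> {RV Pr >-> S}.
Variables (P : R.-pker S ~> S) (pi : probability S R).
Hypothesis XP : markov_chain P X.
Variables (M : S -> R) (m : R) (m1 : 1 < m).
Hypotheses (mM : measurable_fun setT M) (M0 : forall x, 0 <= M x).
Hypothesis iM : (\int[pi]_x (M x)%:E < +oo)%E.
Hypothesis TVM : forall (x : S) (n : nat), (0 < n)%N ->
  (Defs.total_variation (nstep P n x) pi <= (M x * n%:R `^ (- m))%:E)%E.
Variables (C : R).
Hypothesis rC : forall N, \sum_(1 <= k < N) k%:R `^ (- m) <= C.
Variables (K0 : R) (K0_ge0 : 0 <= K0).
Variables (h : S -> R).
Hypotheses (mh : measurable_fun setT h) (h1 : forall x, `|h x| <= 1).
Hypothesis pih : \int[pi]_x h x = 0.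
Variables (v0 K : R) (U U1 U2 : R -> R -> R).
Hypothesis UK : heat_test v0 K U U1 U2.
Variable sigma2 : R.
Hypothesis sigma2_ge0 : 0 <= sigma2.

Let Pr1 : Pr setT = 1%E. Proof. exact: probability_setT. Qed.
Let bh : bmf h. Proof. exact: bmf_le h1. Qed.
Let bX n (f : S -> R) : bmf f -> bmf (fun w => f (X n w)).
Proof. by move=> bf; exact: bmf_comp. Qed.
Let r (k : nat) : R := k%:R `^ (- m).
Let e (w : Omega) : R := \1_(small_start X M K0) w.
Let be : bmf e. Proof. exact: past_bmf (past_small_start X mM K0 0). Qed.
Let e0 w : 0 <= e w. Proof. by rewrite /e indicE. Qed.
Let e1 w : e w <= 1.
Proof. by rewrite /e indicE; case: (_ \in _). Qed.
Let D := mixing_constant pi M K0.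
Let D0 : 0 <= D. Proof. exact: mixing_constant_ge0. Qed.
Let KK : 0 <= K.
Proof.
by have [+ _ _] := heat_test_bounded UK 0 (lexx v0); apply: le_trans.
Qed.

(** The asymptotic variance with the covariances at lag greater than l left
    out. *)
Definition truncated_variance (l : nat) : R :=
  autocov P pi h 0 + 2 * \sum_(1 <= k < l.+1) autocov P pi h k.

Definition partial_sum (s : R) (k : nat) (w : Omega) : R :=
  s * \sum_(0 <= i < k) h (X i w).

Lemma past_partial_sum s k n : (k <= n.+1)%N -> past X n (partial_sum s k).
Proof.
move=> kn; apply: pastZ.
rewrite (_ : (fun w => _) = fun w =>
    \sum_(i <- index_iota 0 k) if (i < k)%N then h (X i w) else 0).
  apply: past_sum => i; case: ltnP => ik; last exact: past_cst.
  by apply: past_at => //; rewrite -ltnS (leq_trans ik).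
by apply/funext => w; rewrite big_nat [RHS]big_nat; apply: eq_bigr => i /andP[_ ->].
Qed.

Let bA s k : bmf (partial_sum s k).
Proof. exact: past_bmf (past_partial_sum s (leqnSn k)). Qed.

(* This times 2 l bounds the second moment of a sum over 2 l steps. *)
Let W (l : nat) : R := 1 + 2 * D * (C + (2 * l)%:R * r l).

(** The quadratic term of the expansion: all covariances at lag at most l are
    seen by the truncated variance, the others are lost in the mixing error. *)
Lemma quadratic_term (l t : nat) (Z : Omega -> R) :
  (0 < l)%N -> (l <= t)%N -> past X t Z ->
  (forall w, `|Z w| <= K * e w) ->
  `|\int[Pr]_w (Z w * (\sum_(t <= i < t + 2 * l) h (X i w) * h (X (t + 2 * l)%N w)
      + h (X (t + 2 * l)%N w) ^+ 2 / 2 - sigma2 / 2))|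
  <= (2 * l)%:R * (K * (D * (r l + r l))) + K * (D * (r l + r l)) / 2
     + K * `|truncated_variance l - sigma2| / 2.
Proof.
move=> l0 lt pZ ZK; have bZ := past_bmf pZ.
have t0 : (0 < t)%N by exact: leq_trans lt.
have rl k : (l <= k)%N -> r k <= r l by move=> lk; exact: powRN_nincr.
pose i := (t + 2 * l)%N; pose I := \int[Pr]_w Z w.
pose F k w := Z w * h (X (i - k)%N w) * h (X i w).
have bF k : bmf (F k) by apply: bmfM; [apply: bmfM => //|]; exact: bX.
have -> : (fun w => Z w * (\sum_(t <= i0 < t + 2 * l) h (X i0 w) * h (X i w)
      + h (X i w) ^+ 2 / 2 - sigma2 / 2)) =
    fun w => \sum_(1 <= k < (2 * l).+1) F k w + (2^-1 * F 0%N w - sigma2 / 2 * Z w).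
  apply/funext => w; rewrite big_nat_backward addrA.
  rewrite mulrBr mulrDr mulr_sumr; congr (_ + _ - _); last by rewrite mulrC.
    by apply: eq_bigr => k _; rewrite /F mulrA.
  by rewrite /F subn0 expr2; ring.
rewrite (meanD Pr1); last 2 first.
- exact: bmf_sum.
- by apply: bmfB; exact: bmfZ.
rewrite (mean_sum Pr1)// (meanB Pr1); [|exact: bmfZ..].
rewrite !(meanZ Pr1)// -/I.
(* At lag k <= l the pair is separated from the past at time t by a gap of at
   least l. *)
have near_lag k : (k <= l)%N ->
    `|\int[Pr]_w F k w - I * autocov P pi h k| <= K * (D * (r l + r l)).
  move=> kl.
  have kl2 : (k <= 2 * l)%N by rewrite (leq_trans kl)// leq_pmull.
  have j0 : (l <= 2 * l - k)%N by rewrite mul2n -addnn -addnBA// leq_addr.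
  have jl : (0 < 2 * l - k)%N by exact: leq_trans j0.
  have := mixing_pair XP mM M0 iM TVM K0_ge0 mh h1 k t0 jl pZ KK ZK.
  rewrite addnBA// -/i subnK; last by rewrite (leq_trans kl2)// leq_addl.
  move=> /le_trans; apply; rewrite ler_wpM2l// ler_wpM2l// lerD// ?rl//.
(* At lag k > l the later factor is separated by k from the earlier one, which
   is counted with the past; as h is centred, the main term vanishes. *)
have far_lag k : (l < k <= 2 * l)%N ->
    `|\int[Pr]_w F k w| <= K * (D * (r l + r l)).
  move=> /andP[lk k2l].
  have ki : (k <= i)%N by rewrite (leq_trans k2l)// leq_addl.
  have ti : (t <= i - k)%N by rewrite /i -addnBA// leq_addr.
  have pZh : past X (i - k) (fun w => Z w * h (X (i - k)%N w)).
    by apply: pastM; [exact: past_mono pZ|exact: past_at].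
  have := @mixing _ _ _ _ _ _ _ _ _ XP _ _ mM M0 iM TVM _ K0_ge0
    (i - k)%N k K _ h (leq_trans t0 ti) (leq_trans l0 (ltnW lk)) pZh KK _ mh h1.
  rewrite pih mulr0 subr0 subnK// => /(_ _)/le_trans; apply.
    move=> w; rewrite normrM -[leRHS]mulr1; apply: ler_pM => //.
  rewrite ler_wpM2l// ler_wpM2l// lerD// ?rl ?(ltnW lk)//.
  exact: leq_trans ti.
have I1 : `|I| <= K.
  by apply: norm_mean_bound => // w; rewrite (le_trans (ZK w))// ler_piMr.
have F0 := near_lag 0%N (leq0n l).
rewrite (@big_cat_nat _ _ _ l.+1)//=; last by rewrite ltnS leq_pmull.
have near_sum : `|\sum_(1 <= k < l.+1) \int[Pr]_w F k w -
    I * \sum_(1 <= k < l.+1) autocov P pi h k| <= l%:R * (K * (D * (r l + r l))).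
  rewrite mulr_sumr -sumrB (le_trans (ler_norm_sum _ _ _))//.
  apply: (@le_trans _ _ (\sum_(1 <= k < l.+1) K * (D * (r l + r l)))).
    by rewrite big_nat [leRHS]big_nat ler_sum// => k /andP[_ kl]; exact: near_lag.
  by rewrite big_const_nat subSS subn0 iter_addr_0 mulr_natl.
have far_sum : `|\sum_(l.+1 <= k < (2 * l).+1) \int[Pr]_w F k w| <=
    l%:R * (K * (D * (r l + r l))).
  rewrite (le_trans (ler_norm_sum _ _ _))//.
  apply: (@le_trans _ _ (\sum_(l.+1 <= k < (2 * l).+1) K * (D * (r l + r l)))).
    by rewrite big_nat [leRHS]big_nat ler_sum// => k kl; exact: far_lag.
  by rewrite big_const_nat subSS mul2n -addnn addnK iter_addr_0 mulr_natl.
rewrite /truncated_variance.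
move: near_sum far_sum F0 I1.
set a1 := \sum_(1 <= k < l.+1) \int[Pr]_w F k w.
set a2 := \sum_(l.+1 <= k < _) _; set a3 := \int[Pr]_w F 0%N w.
set g0 := autocov _ _ _ 0; set gs := \sum_(1 <= k < l.+1) autocov _ _ _ _.
set E := K * (D * _) => n1 n2 n3 I1.
have -> : a1 + a2 + (2^-1 * a3 - sigma2 / 2 * I) =
  (a1 - I * gs) + a2 + 2^-1 * (a3 - I * g0) + I * (g0 + 2 * gs - sigma2) / 2.
  by field.
have -> : (2 * l)%:R * E = l%:R * E + l%:R * E by rewrite natrM; ring.
apply: le_trans (ler_normD _ _) _; apply: lerD; last first.
  by rewrite !normrM (@ger0_norm _ 2^-1)// ler_wpM2r// ler_wpM2r.
apply: le_trans (ler_normD _ _) _; apply: lerD; last first.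
  by rewrite normrM (@ger0_norm _ 2^-1)// mulrC ler_wpM2r.
by apply: le_trans (ler_normD _ _) _; apply: lerD.
Qed.

(** From top to bottom: the linear term, the quadratic term, the second moment
    of the window in the cubic term and in the displacement of the heat term, and
    what remains of these two terms, with the second-order error of the heat
    flow. *)
Definition lindeberg_error (s : R) (l : nat) : R :=
  s * (K * (D * (r l + r l))) +
  s ^+ 2 * ((2 * l)%:R * (K * (D * (r l + r l))) + K * (D * (r l + r l)) / 2
     + K * `|truncated_variance l - sigma2| / 2) +
  ((2 * K * s ^+ 3 + sigma2 * s ^+ 3 * K / 4 / l%:R) * ((2 * l)%:R * W l) +
   (2 * K * s ^+ 3 + K * (sigma2 * s ^+ 2) ^+ 2 + sigma2 * s ^+ 3 * K / 4 * l%:R)).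

(** With A = A' + s B, where A' stops at time t and s B is the sum over the
    window, the increment is that of U v from A to A + s h, minus that of the heat
    flow at A.  Both are expanded with derivatives taken at A', which are
    functions of the past at time t.  The first-order heat term
    (sigma2 s^2 / 2) U2 v A' is put together with the quadratic term. *)
Lemma lindeberg_step (s v : R) (l t : nat) :
  0 <= s -> (0 < l)%N -> (l <= t)%N -> v0 <= v ->
  `|\int[Pr]_w (e w * (U v (partial_sum s (t + 2 * l).+1 w)
      - U (v + sigma2 * s ^+ 2) (partial_sum s (t + 2 * l) w)))|
  <= lindeberg_error s l.
Proof.
move=> s0 l0 lt v0v.
have t0 : (0 < t)%N by exact: leq_trans lt.
have rl k : (l <= k)%N -> r k <= r l by move=> lk; exact: powRN_nincr.
pose i := (t + 2 * l)%N; rewrite -/i.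
have [mU mU1 mU2] := heat_test_measurable UK v.
have [mU' _ _] := heat_test_measurable UK (v + sigma2 * s ^+ 2).
have s2 : 0 <= sigma2 * s ^+ 2 by rewrite mulr_ge0// sqr_ge0.
have bU u x : v0 <= u -> `|U u x| <= K.
  by move=> uv; have [] := heat_test_bounded UK x uv.
have bU1 x : `|U1 v x| <= K by have [] := heat_test_bounded UK x v0v.
have bU2 x : `|U2 v x| <= K by have [] := heat_test_bounded UK x v0v.
pose Z1 w := e w * U1 v (partial_sum s t w).
pose Z2 w := e w * U2 v (partial_sum s t w).
have pe : past X t e by exact: past_small_start.
have pZ1 : past X t Z1.
  apply: pastM => //; apply: past_comp => //; first by exists K.
  exact: past_partial_sum.
have pZ2 : past X t Z2.
  apply: pastM => //; apply: past_comp => //; first by exists K.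
  exact: past_partial_sum.
have Z1K w : `|Z1 w| <= K * e w by rewrite normrM ger0_norm// mulrC ler_wpM2r.
have Z2K w : `|Z2 w| <= K * e w by rewrite normrM ger0_norm// mulrC ler_wpM2r.
pose B w := \sum_(t <= k < t + 2 * l) h (X k w).
have bhX k : bmf (fun w => h (X k w)) by exact: bX.
have bB : bmf B by exact: bmf_sum.
pose Q w := \sum_(t <= k < t + 2 * l) h (X k w) * h (X i w)
   + h (X i w) ^+ 2 / 2 - sigma2 / 2.
have QE w : Q w = B w * h (X i w) + h (X i w) ^+ 2 / 2 - sigma2 / 2.
  by rewrite /Q /B mulr_suml.
have bsq f : bmf f -> bmf (fun w : Omega => f w ^+ 2).
  by move=> bf; under eq_fun do rewrite expr2; exact: bmfM.
have bQ : bmf Q.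
  rewrite (_ : Q = fun w => B w * h (X i w) + 2^-1 * h (X i w) ^+ 2 - sigma2 / 2).
    apply: bmfB; last exact: bmf_cst.
    by apply: bmfD; [exact: bmfM|apply: bmfZ; exact: bsq].
  by apply/funext => w; rewrite QE [2^-1 * _]mulrC.
have AiE w : partial_sum s i w = partial_sum s t w + s * B w.
  rewrite /partial_sum /i -mulrDr; congr (_ * _).
  by rewrite (@big_cat_nat _ _ _ t)//= leq_addr.
have ASE w : partial_sum s i.+1 w = partial_sum s t w + s * B w + s * h (X i w).
  by rewrite -AiE /partial_sum -mulrDr big_nat_recr.
pose c2 := 2 * K * s ^+ 3 + sigma2 * s ^+ 3 * K / 4 / l%:R.
pose c0 := 2 * K * s ^+ 3 + K * (sigma2 * s ^+ 2) ^+ 2 + sigma2 * s ^+ 3 * K / 4 * l%:R.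
pose T w := e w * (U v (partial_sum s i.+1 w) -
  U (v + sigma2 * s ^+ 2) (partial_sum s i w)).
have bT : bmf T.
  apply: bmfM => //; apply: bmfB.
    apply: (@bmf_le _ _ _ _ K); last by move=> w; exact: bU.
    by apply: measurableT_comp => //; exact: (bA s _).1.
  apply: (@bmf_le _ _ _ _ K); last by move=> w; apply: bU; rewrite (le_trans v0v)// lerDl.
  by apply: measurableT_comp => //; exact: (bA s _).1.
have l0R : 0 < l%:R :> R by rewrite ltr0n.
have main w : `|T w - s * (Z1 w * h (X i w)) - s ^+ 2 * (Z2 w * Q w)|
    <= c2 * (e w * B w ^+ 2) + c0.
  rewrite /T /Z1 /Z2 QE.
  set A := partial_sum s t w; set Ai := partial_sum s i w.
  have := heat_test_taylor UK A (s * B w) (s * h (X i w)) v0v.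
  have := heat_test_heat UK Ai v0v s2.
  have := heat_test_lipschitz2 UK Ai A v0v.
  rewrite ASE -AiE -/Ai.
  have -> : Ai - A = s * B w by rewrite /Ai /A AiE addrC addKr.
  set b := B w; set z := h (X i w).
  set u1 := U v (Ai + s * z); set u2 := U (v + _) Ai; set u3 := U v Ai.
  set d1 := U1 v A; set d2 := U2 v A; set d3 := U2 v Ai => L2 H T3.
  have z1 : `|z| <= 1 by exact: h1.
  have -> : e w * (u1 - u2) - s * (e w * d1 * z) -
      s ^+ 2 * (e w * d2 * (b * z + z ^+ 2 / 2 - sigma2 / 2)) =
    e w * ((u1 - u3 - d1 * (s * z) - d2 * (s * b * (s * z) + (s * z) ^+ 2 / 2))
      - (u2 - u3 - sigma2 * s ^+ 2 / 2 * d3) - sigma2 * s ^+ 2 / 2 * (d3 - d2)).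
    by field.
  have T1 : K * ((`|s * b| + `|s * z|) ^+ 2 * `|s * z|) <=
      2 * K * s ^+ 3 * (b ^+ 2 + 1).
    rewrite !normrM (ger0_norm s0).
    have -> : K * ((s * `|b| + s * `|z|) ^+ 2 * (s * `|z|)) =
      K * s ^+ 3 * ((`|b| + `|z|) ^+ 2 * `|z|) by ring.
    have -> : 2 * K * s ^+ 3 * (b ^+ 2 + 1) = K * s ^+ 3 * (2 * (b ^+ 2 + 1)) by ring.
    rewrite ler_wpM2l ?mulr_ge0 ?exprn_ge0//.
    rewrite -(real_normK (num_real b)).
    have := normr_ge0 b; have := normr_ge0 z; move: z1.
    move: (`|z|) (`|b|) => x y x1 x0 y0.
    apply: (@le_trans _ _ ((y + x) ^+ 2)); first by rewrite ler_piMr ?sqr_ge0.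
    have x2 : x ^+ 2 <= 1 by rewrite exprn_ile1.
    by have := sqr_ge0 (y - x); nra.
  have T2 : `|sigma2 * s ^+ 2 / 2 * (d3 - d2)| <=
      sigma2 * s ^+ 3 * K / 4 * (b ^+ 2 / l%:R + l%:R).
    rewrite normrM ger0_norm; last by rewrite divr_ge0.
    apply: (@le_trans _ _ (sigma2 * s ^+ 2 / 2 * (K * `|s * b|))).
      by rewrite ler_wpM2l// divr_ge0.
    rewrite normrM (ger0_norm s0).
    have -> : sigma2 * s ^+ 2 / 2 * (K * (s * `|b|)) =
      sigma2 * s ^+ 3 * K / 4 * (2 * `|b|) by field.
    rewrite ler_wpM2l ?divr_ge0// ?mulr_ge0// ?exprn_ge0//.
    (* |b| has typical size sqrt l, so the weight l in 2 |b| <= b^2 / l + l loses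
       something, but it avoids square roots and s l still vanishes. *)
    have -> : b ^+ 2 / l%:R + l%:R = (b ^+ 2 + l%:R ^+ 2) / l%:R.
      by field; rewrite gt_eqF.
    rewrite ler_pdivlMr// -(real_normK (num_real b)).
    by have := sqr_ge0 (`|b| - l%:R); nra.
  rewrite normrM ger0_norm//.
  apply: (@le_trans _ _ (e w * (2 * K * s ^+ 3 * (b ^+ 2 + 1) +
     K * (sigma2 * s ^+ 2) ^+ 2 +
     sigma2 * s ^+ 3 * K / 4 * (b ^+ 2 / l%:R + l%:R)))).
    rewrite ler_wpM2l//.
    apply: le_trans (ler_normB _ _) _; apply: lerD => //.
    apply: le_trans (ler_normB _ _) _; apply: lerD => //.
    exact: le_trans T3 T1.
  have -> : 2 * K * s ^+ 3 * (b ^+ 2 + 1) + K * (sigma2 * s ^+ 2) ^+ 2 +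
     sigma2 * s ^+ 3 * K / 4 * (b ^+ 2 / l%:R + l%:R) = c2 * b ^+ 2 + c0.
    by rewrite /c2 /c0; field; rewrite gt_eqF.
  rewrite mulrDr mulrCA lerD2l ler_piMl// /c0.
  by rewrite !addr_ge0// !mulr_ge0// ?exprn_ge0// ?sqr_ge0.
have -> : \int[Pr]_w T w = s * (\int[Pr]_w (Z1 w * h (X i w))) +
    s ^+ 2 * (\int[Pr]_w (Z2 w * Q w)) +
    \int[Pr]_w (T w - s * (Z1 w * h (X i w)) - s ^+ 2 * (Z2 w * Q w)).
  have bZ1 := past_bmf pZ1; have bZ2 := past_bmf pZ2.
  have b1 : bmf (fun w => Z1 w * h (X i w)) by exact: bmfM.
  have b2 : bmf (fun w => Z2 w * Q w) by exact: bmfM.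
  rewrite (meanB Pr1); [|by apply: bmfB => //; exact: bmfZ|exact: bmfZ].
  rewrite (meanB Pr1)//; last exact: bmfZ.
  by rewrite !(meanZ Pr1)//; ring.
rewrite /lindeberg_error.
apply: le_trans (ler_normD _ _) _; apply: lerD.
  apply: le_trans (ler_normD _ _) _; apply: lerD.
    rewrite normrM ger0_norm// ler_wpM2l//.
    have l2 : (0 < 2 * l)%N by rewrite muln_gt0.
    have := mixing XP mM M0 iM TVM K0_ge0 t0 l2 pZ1 KK Z1K mh h1.
    rewrite pih mulr0 subr0 -/i => /le_trans; apply.
    rewrite ler_wpM2l// ler_wpM2l// lerD// ?rl// leq_pmull//.
  rewrite normrM ger0_norm ?sqr_ge0// ler_wpM2l ?sqr_ge0//.
  exact: quadratic_term.
have c20 : 0 <= c2.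
  by rewrite addr_ge0// ?divr_ge0// !mulr_ge0// ?exprn_ge0.
apply: (@le_trans _ _ (\int[Pr]_w (c2 * (e w * B w ^+ 2) + c0))).
  apply: norm_mean_le => //; last first.
    apply: bmfD; last exact: bmf_cst.
    by apply: bmfZ; apply: bmfM => //; exact: bsq.
  apply: bmfB; last by apply: bmfZ; apply: bmfM => //; exact: past_bmf pZ2.
  by apply: bmfB => //; apply: bmfZ; apply: bmfM => //; exact: past_bmf pZ1.
have beB : bmf (fun w => e w * B w ^+ 2) by apply: bmfM => //; exact: bsq.
rewrite (meanD Pr1); [|exact: bmfZ|exact: bmf_cst].
rewrite (mean_cst Pr1) (meanZ Pr1)// lerD2r ler_wpM2l//.
exact: (window_second_moment XP mM M0 iM TVM K0_ge0 mh h1 pih).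
Qed.

(** The sum of the increments from time 3 l to n telescopes.  The first 3 l
    terms, for which no window of length 2 l starts after time l, are dropped: they
    move the partial sum by at most 3 s l, and the variance by 3 s^2 l sigma2. *)
Theorem lindeberg (n l : nat) (s : R) : (0 < l)%N -> (3 * l <= n)%N ->
  s = (Num.sqrt n%:R)^-1 ->
  `|\int[Pr]_w (e w * U v0 (partial_sum s n w)) -
    \int[Pr]_w e w * U (v0 + sigma2) 0| <=
  n%:R * lindeberg_error s l + K * (3 * (s * l%:R)) +
  (K * (3 * (s * (s * l%:R)) * sigma2) / 2 + K * (3 * (s * (s * l%:R)) * sigma2) ^+ 2).
Proof.
move=> l0 ln sE.
have n0 : (0 < n)%N by rewrite (leq_trans _ ln)// muln_gt0.
have s0 : 0 <= s by rewrite sE invr_ge0.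
have ns2 : n%:R * s ^+ 2 = 1.
  by rewrite sE exprVn sqr_sqrtr// mulfV// pnatr_eq0 -lt0n.
pose v i : R := v0 + (n - i)%:R * (sigma2 * s ^+ 2).
have s2 : 0 <= sigma2 * s ^+ 2 by rewrite mulr_ge0// sqr_ge0.
have v0v i : v0 <= v i by rewrite lerDl mulr_ge0.
have bUA i k : bmf (fun w => e w * U (v i) (partial_sum s k w)).
  apply: bmfM => //; apply: (@bmf_le _ _ _ _ K).
    have [mU _ _] := heat_test_measurable UK (v i).
    by apply: measurableT_comp => //; exact: (bA s _).1.
  by move=> w; have [] := heat_test_bounded UK (partial_sum s k w) (v0v i).
pose G i := \int[Pr]_w (e w * U (v i) (partial_sum s i w)).
have telescope_bound : `|G n - G (3 * l)%N| <= n%:R * lindeberg_error s l.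
  rewrite -telescope_sumr// (le_trans (ler_norm_sum _ _ _))//.
  have stepE i : (3 * l <= i < n)%N -> `|G i.+1 - G i| <= lindeberg_error s l.
    move=> /andP[li iln].
    have vS : v i = v i.+1 + sigma2 * s ^+ 2.
      rewrite /v -addrA; congr (_ + _).
      by rewrite -(subnSK iln) -natr1 mulrDl mul1r.
    have it : i = (i - 2 * l + 2 * l)%N.
      by rewrite subnK// (leq_trans _ li)// leq_mul2r orbT.
    have lt : (l <= i - 2 * l)%N.
      by rewrite leq_subRL ?(leq_trans _ li)// ?leq_mul2r ?orbT// addnC -mulSn.
    have := @lindeberg_step s (v i.+1) l (i - 2 * l)%N s0 l0 lt (v0v _).
    rewrite -it -vS; congr (`|_| <= _).
    rewrite /G -(meanB Pr1)//; apply: eq_Rintegral => w _.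
    by rewrite mulrBr.
  apply: (@le_trans _ _ (\sum_(3 * l <= i < n) lindeberg_error s l)).
    by rewrite big_nat [leRHS]big_nat ler_sum.
  rewrite big_const_nat iter_addr_0 -[X in X <= _]mulr_natl ler_wpM2r// ?ler_nat ?leq_subr//.
  exact: le_trans (normr_ge0 _) (@lindeberg_step s v0 l l s0 l0 (leqnn l) (lexx _)).
have vn : v n = v0 by rewrite /v subnn mul0r addr0.
have G3 : `|G (3 * l)%N - \int[Pr]_w e w * U (v (3 * l)%N) 0| <= K * (3 * (s * l%:R)).
  rewrite mulrC -(meanZ Pr1)// -(meanB Pr1)//; last exact: bmfZ.
  apply: norm_mean_bound => //.
    by apply: bmfB => //; exact: bmfZ.
  move=> w; rewrite [X in _ - X]mulrC -mulrBr normrM ger0_norm//.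
  apply: (@le_trans _ _ `|U (v (3 * l)%N) (partial_sum s (3 * l) w) - U (v (3 * l)%N) 0|).
    by rewrite ler_piMl.
  apply: le_trans (heat_test_lipschitz UK _ _ (v0v _)) _.
  rewrite ler_wpM2l// subr0 normrM ger0_norm// mulrCA ler_wpM2l//.
  apply: le_trans (ler_norm_sum _ _ _) _.
  apply: (@le_trans _ _ (\sum_(0 <= i < 3 * l) 1)); first by rewrite ler_sum.
  by rewrite big_const_nat iter_addr_0 subn0 natrM.
have e1m : `|\int[Pr]_w e w| <= 1.
  by apply: norm_mean_bound => // w; rewrite ger0_norm.
pose dv := 3 * (s * (s * l%:R)) * sigma2.
have vd : v0 + sigma2 = v (3 * l)%N + dv.
  rewrite /v /dv natrB// mulrBl mulrCA ns2 natrM; ring.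
have dv0 : 0 <= dv by rewrite !mulr_ge0.
have Gv : `|\int[Pr]_w e w * U (v (3 * l)%N) 0 - \int[Pr]_w e w * U (v0 + sigma2) 0|
    <= K * dv / 2 + K * dv ^+ 2.
  rewrite -mulrBr normrM; apply: (@le_trans _ _
    `|U (v (3 * l)%N) 0 - U (v0 + sigma2) 0|); first by rewrite ler_piMl.
  have := heat_test_heat UK 0 (v0v (3 * l)%N) dv0; rewrite -vd.
  have [_ _] := heat_test_bounded UK 0 (v0v (3 * l)%N).
  set a := U (v0 + sigma2) 0; set b := U (v (3 * l)%N) 0.
  set c := U2 _ _ => cK H.
  rewrite distrC (_ : a - b = (a - b - dv / 2 * c) + dv / 2 * c); last by ring.
  apply: le_trans (ler_normD _ _) _; rewrite addrC lerD//.
  by rewrite normrM ger0_norm ?divr_ge0// mulrC mulrA ler_wpM2r// ler_wpM2r.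
have -> : \int[Pr]_w (e w * U v0 (partial_sum s n w)) = G n by rewrite /G vn.
rewrite (_ : _ - _ = (G n - G (3 * l)%N) +
  (G (3 * l)%N - \int[Pr]_w e w * U (v (3 * l)%N) 0) +
  (\int[Pr]_w e w * U (v (3 * l)%N) 0 - \int[Pr]_w e w * U (v0 + sigma2) 0));
  last by ring.
apply: le_trans (ler_normD _ _) _; apply: lerD => //.
by apply: le_trans (ler_normD _ _) _; apply: lerD.
Qed.

End lindeberg.

(** * Gaussian smoothing *)

Section derivative_rules.
Context (R : realType).
Implicit Types (f g : R -> R) (x : R).

Lemma is_derive_mul f g x df dg : is_derive x 1 f df -> is_derive x 1 g dg ->
  is_derive x 1 (fun t => f t * g t) (df * g x + f x * dg).
Proof.
move=> hf hg.
have h : is_derive x 1 (fun t => f t * g t) _ := is_deriveM hf hg.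
by apply: (is_derive_eq h); rewrite /GRing.scale/= addrC mulrC.
Qed.

Lemma is_derive_scale f x df a : is_derive x 1 f df ->
  is_derive x 1 (fun t => a * f t) (a * df).
Proof.
move=> hf; have h := is_derive_mul (is_derive_cst a _ _) hf.
by apply: (is_derive_eq h); rewrite mul0r add0r.
Qed.

Lemma is_derive_add f g x df dg : is_derive x 1 f df -> is_derive x 1 g dg ->
  is_derive x 1 (fun t => f t + g t) (df + dg).
Proof. by move=> hf hg; exact: is_deriveD. Qed.

Lemma is_derive_sub f g x df dg : is_derive x 1 f df -> is_derive x 1 g dg ->
  is_derive x 1 (fun t => f t - g t) (df - dg).
Proof. by move=> hf hg; exact: is_deriveB. Qed.

Lemma is_derive_chain f g x df dg : is_derive (g x) 1 f df ->
  is_derive x 1 g dg -> is_derive x 1 (fun t => f (g t)) (df * dg).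
Proof. by move=> hf hg; exact: is_derive1_comp. Qed.

Lemma mean_value_le f df (a b c : R) : a <= b ->
  (forall x, a <= x <= b -> is_derive x 1 f (df x)) ->
  (forall x, a <= x <= b -> `|df x| <= c) -> `|f b - f a| <= c * (b - a).
Proof.
move=> ab dfE dfc.
have [||z zab ->] := @MVT_segment R f df a b ab.
- move=> x; rewrite in_itv/= => /andP[ax xb]; apply: dfE.
  by rewrite (ltW ax) ltW.
- apply: derivable_within_continuous => x; rewrite in_itv/= => xab.
  by have [] := dfE x xab.
- move: zab; rewrite in_itv/= => /dfc zc.
  by rewrite normrM (ger0_norm (_ : 0 <= b - a)) ?subr_ge0// ler_wpM2r// subr_ge0.
Qed.

Lemma mean_value_norm f df (a b c : R) :
  (forall x, is_derive x 1 f (df x)) ->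
  (forall x, `|x - a| <= `|b - a| -> `|df x| <= c) ->
  `|f b - f a| <= c * `|b - a|.
Proof.
move=> dfE dfc; have [ab|/ltW ba] := leP a b.
  rewrite (ger0_norm (_ : 0 <= b - a)) ?subr_ge0//.
  apply: mean_value_le => // x /andP[ax xb]; apply: dfc.
  by rewrite !ger0_norm ?subr_ge0// lerD2r.
rewrite distrC [in leRHS]distrC (ger0_norm (_ : 0 <= a - b)) ?subr_ge0//.
apply: mean_value_le => // x /andP[bx xa]; apply: dfc.
by rewrite distrC [leRHS]distrC !ger0_norm ?subr_ge0// lerD2l lerN2.
Qed.

End derivative_rules.

Section lower_integral.
Context (R : realType).
Notation mu := (@lebesgue_measure R).

Lemma is_derive_lower_integral (f : R -> R) (x : R) :
  (forall y, mu.-integrable `]-oo, y] (EFin \o f)) -> continuous f ->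
  is_derive x 1 (fun y => \int[mu]_(t in `]-oo, y]) f t) (f x).
Proof.
move=> fi cf.
have [df fE] := @continuous_FTC1 R f -oo%O x (x + 1) (ltr_pwDr ltr01 (lexx x))
  (fi _) (ltNyr _) (cf x).
by split; [exact: df|rewrite -derive1E; exact: fE].
Qed.

End lower_integral.

Section cdf_limits.
Context {R : realType} (P : probability (measurableTypeR R) R).
Local Open Scope measure_display_scope.

Let idTR : measurableTypeR R -> R := idfun.

#[local] HB.instance Definition _ :=
  @isMeasurableFun.Build _ _ _ _ idTR (@measurable_id _ _ setT).

Lemma cvg_probability_Ny0 : fine (P `]-oo, x]%classic) @[x --> -oo] --> (0 : R).
Proof. exact/fine_cvg/(@cvg_cdfNy0 _ _ _ P (idTR : {RV P >-> R})). Qed.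

Lemma cvg_probability_y1 : fine (P `]-oo, x]%classic) @[x --> +oo] --> (1 : R).
Proof. exact/fine_cvg/(@cvg_cdfy1 _ _ _ P (idTR : {RV P >-> R})). Qed.

End cdf_limits.

Section standard_normal.
Context (R : realType).
Notation mu := (@lebesgue_measure R).

Definition ndens (x : R) : R := normal_pdf 0 1 x.
Definition Phi (x : R) : R := \int[mu]_(t in `]-oo, x]) ndens t.

Let peak : R := normal_peak 1.
Let peak_ge0 : 0 <= peak. Proof. exact: normal_peak_ge0. Qed.

Lemma ndensE x : ndens x = peak * expR (- (x ^+ 2 / 2)).
Proof. by rewrite /ndens normal_pdfE// /normal_fun subr0 expr1n mulNr. Qed.

Lemma is_derive_Phi (x : R) : is_derive x 1 Phi (ndens x).
Proof.
apply: is_derive_lower_integral => [y|].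
  by apply: integrableS (integrable_normal_pdf 0 1).
exact: continuous_normal_pdf.
Qed.

Lemma is_derive_ndens (x : R) : is_derive x 1 ndens (- (x * ndens x)).
Proof.
have -> : ndens = fun x => peak * expR (- 2^-1 * (x * x)).
  by apply/funext => y; rewrite ndensE; congr (_ * expR _); field.
have hq : is_derive x 1 (fun t : R => - 2^-1 * (t * t)) (- 2^-1 * (1 * x + x * 1)).
  by apply: is_derive_scale; apply: is_derive_mul.
have h := is_derive_scale peak (is_derive_chain (is_derive_expR _) hq).
by apply: (is_derive_eq h); field.
Qed.

(** Both sides have the same derivative and vanish at minus infinity. *)
Lemma PhiE (s x : R) : 0 < s -> normal_prob 0 s `]-oo, x]%classic = (Phi (x / s))%:E.
Proof.
move=> s0; have sn0 : s != 0 by rewrite gt_eqF.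
pose G y := \int[mu]_(t in `]-oo, y]) normal_pdf 0 s t.
have GE y : fine (normal_prob 0 s `]-oo, y]%classic) = G y by [].
have dG (y : R) : is_derive y 1 G (normal_pdf 0 s y).
  apply: is_derive_lower_integral => [z|].
    by apply: integrableS (integrable_normal_pdf 0 s).
  exact: continuous_normal_pdf.
have dH (y : R) : is_derive y 1 (fun y => G y - Phi (y / s)) 0.
  have h := is_derive_sub (dG y) (is_derive_chain (is_derive_Phi _)
    (is_derive_mul (is_derive_id y 1) (is_derive_cst s^-1 y 1))).
  apply: (is_derive_eq h); rewrite mul1r mulr0 addr0 ndensE.
  have -> : normal_pdf 0 s y = s^-1 * (peak * expR (- ((y * s^-1) ^+ 2 / 2))).
    rewrite normal_pdfE// /normal_fun subr0 mulrA; congr (_ * expR _).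
      rewrite /peak /normal_peak expr1n mul1r -mulrnAr.
      by rewrite sqrtrM ?sqr_ge0// sqrtr_sqr gtr0_norm// invfM.
    by field; exact: sn0.
  by rewrite /=; ring.
have H0 y : G y - Phi (y / s) = 0.
  have cst z : G z - Phi (z / s) = G y - Phi (y / s).
    exact: (is_derive_0_is_cst z y dH).
  have limH : (G z - Phi (z / s)) @[z --> -oo] --> (0 - 0 : R).
    apply: cvgB; first exact: (cvg_probability_Ny0 (normal_prob 0 s)).
    apply: (cvg_comp (fun z => z / s) Phi); last exact: (cvg_probability_Ny0 (normal_prob 0 1)).
    by apply/gt0_cvgMlNy; [rewrite invr_gt0|exact: cvg_id].
  rewrite subrr in limH.
  have limC : (G z - Phi (z / s)) @[z --> -oo] --> G y - Phi (y / s).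
    by under eq_fun do rewrite cst; exact: cvg_cst.
  exact: (cvg_unique _ limC limH).
have := H0 x => /eqP; rewrite subr_eq0 => /eqP <-.
by rewrite -GE fineK// fin_num_measure.
Qed.

Lemma Phi_ge0 x : 0 <= Phi x.
Proof. by apply: Rintegral_ge0 => y _; exact: normal_pdf_ge0. Qed.

Lemma Phi_normal_prob x : (Phi x)%:E = normal_prob 0 1 `]-oo, x]%classic.
Proof. by rewrite PhiE// divr1. Qed.

Lemma Phi_le1 x : Phi x <= 1.
Proof. by rewrite -lee_fin Phi_normal_prob probability_le1. Qed.

Lemma Phi_nondecreasing x y : x <= y -> Phi x <= Phi y.
Proof.
move=> xy; rewrite -lee_fin !Phi_normal_prob le_measure ?inE//.
exact: subitvPr.
Qed.

Lemma continuous_Phi : continuous Phi.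
Proof.
move=> x; apply/differentiable_continuous/derivable1_diffP.
by have [] := is_derive_Phi x.
Qed.

(** The Gaussian weight absorbs all powers up to the third. *)
Lemma ndens_moments x : [/\ ndens x <= 4 * peak, `|x| * ndens x <= 4 * peak,
  x ^+ 2 * ndens x <= 4 * peak & `|x| ^+ 3 * ndens x <= 4 * peak].
Proof.
(* The square of exp y >= 1 + y, for y = x^2 / 4, controls exp (x^2 / 2). *)
pose y : R := x ^+ 2 / 4.
have y0 : 0 <= y by rewrite divr_ge0// sqr_ge0.
have ey : (1 + y) ^+ 2 * expR (- (x ^+ 2 / 2)) <= 1.
  have -> : x ^+ 2 / 2 = y + y by rewrite /y; field.
  rewrite expRN expRD ler_pdivrMr ?mulr_gt0 ?expR_gt0// mul1r expr2.
  by rewrite ler_pM ?expR_ge1Dx// addr_ge0.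
have bnd a : a <= 4 * (1 + y) ^+ 2 -> a * ndens x <= 4 * peak.
  move=> ay; rewrite ndensE mulrCA [leRHS]mulrC ler_wpM2l//.
  apply: (@le_trans _ _ (4 * ((1 + y) ^+ 2 * expR (- (x ^+ 2 / 2))))).
    by rewrite mulrA ler_wpM2r// expR_ge0.
  by rewrite ler_piMr.
have xy : `|x| ^+ 2 = 4 * y by rewrite real_normK ?num_real// /y; field.
have x1 : `|x| <= 1 + y by have := sqr_ge0 (`|x| - 2); move: xy; move: (`|x|) => a; nra.
split.
- by rewrite -[leLHS]mul1r; apply: bnd; nra.
- by apply: bnd; nra.
- by rewrite -(real_normK (num_real x)); apply: bnd; nra.
- by apply: bnd; rewrite exprS xy; nra.
Qed.

Lemma cvg_PhiNy : Phi z @[z --> -oo] --> (0 : R).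
Proof. exact: (cvg_probability_Ny0 (normal_prob 0 1)). Qed.

Lemma cvg_Phiy : Phi z @[z --> +oo] --> (1 : R).
Proof. exact: (cvg_probability_y1 (normal_prob 0 1)). Qed.

(** The convolution of the indicator of ]-oo, c] with the centred normal law of
    variance v. *)
Definition smooth (c v x : R) : R := Phi ((c - x) / Num.sqrt v).

Definition smooth1 (c v x : R) : R :=
  - ((Num.sqrt v)^-1 * ndens ((c - x) / Num.sqrt v)).

Definition smooth2 (c v x : R) : R :=
  - ((Num.sqrt v)^-1 ^+ 2 * (((c - x) / Num.sqrt v) * ndens ((c - x) / Num.sqrt v))).

Let smooth3 (c v x : R) : R := (Num.sqrt v)^-1 ^+ 3 *
  ((1 - ((c - x) / Num.sqrt v) ^+ 2) * ndens ((c - x) / Num.sqrt v)).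

Let arg_derive (c w x : R) : is_derive x 1 (fun x => (c - x) * w) (- w).
Proof.
have h : is_derive x 1 (fun x => (c - x) * w) ((0 - 1) * w + (c - x) * 0).
  by apply: is_derive_mul; exact: is_derive_sub.
by apply: (is_derive_eq h); ring.
Qed.

Let is_derive_xndens (y : R) :
  is_derive y 1 (fun y => y * ndens y) ((1 - y ^+ 2) * ndens y).
Proof.
have h := is_derive_mul (is_derive_id y 1) (is_derive_ndens y).
by apply: (is_derive_eq h); rewrite /=; ring.
Qed.

Lemma is_derive_smooth (c v x : R) : is_derive x 1 (smooth c v) (smooth1 c v x).
Proof.
have h := is_derive_chain (is_derive_Phi _) (arg_derive c (Num.sqrt v)^-1 x).
by apply: (is_derive_eq h); rewrite /smooth1; ring.
Qed.

Lemma is_derive_smooth1 (c v x : R) : is_derive x 1 (smooth1 c v) (smooth2 c v x).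
Proof.
have h := is_derive_scale (- (Num.sqrt v)^-1)
  (is_derive_chain (is_derive_ndens _) (arg_derive c (Num.sqrt v)^-1 x)).
have -> : smooth1 c v = fun x => - (Num.sqrt v)^-1 * ndens ((c - x) / Num.sqrt v).
  by apply/funext => y; rewrite /smooth1 mulNr.
by apply: (is_derive_eq h); rewrite /smooth2; ring.
Qed.

Let is_derive_smooth2 (c v x : R) : is_derive x 1 (smooth2 c v) (smooth3 c v x).
Proof.
have h := is_derive_scale (- (Num.sqrt v)^-1 ^+ 2)
  (is_derive_chain (is_derive_xndens _) (arg_derive c (Num.sqrt v)^-1 x)).
have -> : smooth2 c v = fun x => - (Num.sqrt v)^-1 ^+ 2 *
    (((c - x) / Num.sqrt v) * ndens ((c - x) / Num.sqrt v)).
  by apply/funext => y; rewrite /smooth2 mulNr.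
by apply: (is_derive_eq h); rewrite /smooth3; ring.
Qed.

Let invsqrt_derive (v : R) : 0 < v ->
  is_derive v 1 (fun v => (Num.sqrt v)^-1) (- 2^-1 * (Num.sqrt v)^-1 ^+ 3).
Proof.
move=> v0; have sv0 : Num.sqrt v != 0 by rewrite gt_eqF// sqrtr_gt0.
have h := is_deriveV sv0 (is_derive1_sqrt v0).
apply: (is_derive_eq h); rewrite /GRing.scale/=; field; exact: sv0.
Qed.

(* This is half of the second derivative in x: the heat equation. *)
Let is_derive_smooth_variance (c v x : R) : 0 < v ->
  is_derive v 1 (fun v => smooth c v x) (2^-1 * smooth2 c v x).
Proof.
move=> v0.
have h := is_derive_chain (is_derive_Phi _) (is_derive_scale (c - x) (invsqrt_derive v0)).
by apply: (is_derive_eq h); rewrite /smooth2; ring.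
Qed.

Let is_derive_smooth2_variance (c v x : R) : 0 < v ->
  is_derive v 1 (fun v => smooth2 c v x)
   ((Num.sqrt v)^-1 ^+ 4 * (let y := (c - x) / Num.sqrt v in
      2^-1 * (y * ((1 - y ^+ 2) * ndens y)) + y * ndens y)).
Proof.
move=> v0.
have h1 := is_derive_chain (is_derive_xndens _)
  (is_derive_scale (c - x) (invsqrt_derive v0)).
have h2 := is_derive_mul (invsqrt_derive v0) (invsqrt_derive v0).
have h := is_derive_scale (-1) (is_derive_mul h2 h1).
have -> : (fun v => smooth2 c v x) = fun v => -1 * ((Num.sqrt v)^-1 * (Num.sqrt v)^-1 *
    ((c - x) / Num.sqrt v * ndens ((c - x) / Num.sqrt v))).
  by apply/funext => y; rewrite /smooth2 expr2; ring.
apply: (is_derive_eq h) => /=; field.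
by rewrite gt_eqF// sqrtr_gt0.
Qed.

Definition smooth_bound (v0 : R) : R :=
  let w := (Num.sqrt v0)^-1 in 1 + 8 * peak * (w + w ^+ 2 + w ^+ 3 + w ^+ 4).

(** The derivatives are polynomials in y = (c - x) / sqrt v times the Gaussian
    density at y and powers of v^(-1/2), hence bounded for v >= v0; the estimates
    follow from the mean value inequality. *)
Lemma heat_test_smooth (c v0 : R) : 0 < v0 ->
  heat_test v0 (smooth_bound v0) (smooth c) (smooth1 c) (smooth2 c).
Proof.
move=> v00; pose K := smooth_bound v0; rewrite -/K.
pose w0 := (Num.sqrt v0)^-1.
have w00 : 0 <= w0 by rewrite invr_ge0.
have wv v : v0 <= v -> 0 <= (Num.sqrt v)^-1 <= w0.
  move=> vv; rewrite invr_ge0 sqrtr_ge0/= lef_pV2 ?posrE ?sqrtr_gt0//.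
    by rewrite ler_sqrt// ltW// (lt_le_trans v00).
  exact: lt_le_trans vv.
have p8 : 0 <= 8 * peak by rewrite mulr_ge0.
have KE : K = 1 + 8 * peak * (w0 + w0 ^+ 2 + w0 ^+ 3 + w0 ^+ 4) by [].
have pw k : 0 <= 8 * peak * w0 ^+ k by rewrite mulr_ge0 ?exprn_ge0.
have := pw 1%N; have := pw 2%N; have := pw 3%N; have := pw 4%N.
rewrite expr1 => q4 q3 q2 q1.
have Kw k a v : v0 <= v -> k \in [:: 1; 2; 3; 4]%N -> `|a| <= 8 * peak ->
    `|(Num.sqrt v)^-1 ^+ k * a| <= K.
  move=> vv k4 ap; apply: (@le_trans _ _ (w0 ^+ k * (8 * peak))).
    have /andP[wp ww] := wv v vv.
    rewrite normrM ger0_norm ?exprn_ge0// ler_pM ?exprn_ge0//.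
    by rewrite lerXn2r ?nnegrE.
  rewrite mulrC KE; move: k4; rewrite !inE => /or4P[] /eqP ->; rewrite ?expr1; lra.
have nd y : 0 <= ndens y by exact: normal_pdf_ge0.
have p2 : 4 * peak <= 8 * peak by have := peak_ge0; lra.
have S2 v x : v0 <= v -> `|smooth2 c v x| <= K.
  move=> vv; rewrite normrN; apply: Kw => //.
  set y := _ / _; have [_ m1 _ _] := ndens_moments y.
  by rewrite normrM (ger0_norm (nd _)) (le_trans m1).
have S1 v x : v0 <= v -> `|smooth1 c v x| <= K.
  move=> vv; rewrite normrN -[X in X * _]expr1; apply: Kw => //.
  set y := _ / _; have [m0 _ _ _] := ndens_moments y.
  by rewrite (ger0_norm (nd _)) (le_trans m0).
have S3 v x : v0 <= v -> `|smooth3 c v x| <= K.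
  move=> vv; apply: Kw => //; set y := _ / _.
  have [m0 _ m2 _] := ndens_moments y.
  rewrite mulrBl mul1r (le_trans (ler_normB _ _))//.
  rewrite (ger0_norm (nd _)) (ger0_norm (mulr_ge0 (sqr_ge0 _) (nd _))).
  move: m0 m2; set a := ndens y; set b := _ * a; lra.
have S2v v x : v0 <= v -> `|(Num.sqrt v)^-1 ^+ 4 * (let y := (c - x) / Num.sqrt v in
      2^-1 * (y * ((1 - y ^+ 2) * ndens y)) + y * ndens y)| <= K.
  move=> vv; apply: Kw => //=; set y := _ / _.
  have [_ m1 _ m3] := ndens_moments y.
  have -> : 2^-1 * (y * ((1 - y ^+ 2) * ndens y)) + y * ndens y =
    3 / 2 * (y * ndens y) - 2^-1 * (y ^+ 3 * ndens y) by field.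
  rewrite (le_trans (ler_normB _ _))//.
  rewrite (normrM (3 / 2)) (normrM 2^-1) !(normrM _ (ndens y)) (normrX 3%N y).
  rewrite (ger0_norm (nd _)) (@ger0_norm _ (3 / 2)) ?divr_ge0//.
  rewrite (@ger0_norm _ 2^-1)//.
  by move: m1 m3; set a := _ * ndens y; set b := _ * ndens y; lra.
have lip2 v x y : v0 <= v -> `|smooth2 c v x - smooth2 c v y| <= K * `|x - y|.
  move=> vv; apply: (mean_value_norm (f := smooth2 c v) (df := smooth3 c v)) => z.
    exact: is_derive_smooth2.
  by move=> _; exact: S3.
have Kge0 : 0 <= K by rewrite (le_trans _ (S2 v0 0 (lexx _))).
have contm (u u' : R -> R) : (forall x : R, is_derive x 1 u (u' x)) ->
    measurable_fun setT u.
  move=> du; apply: continuous_measurable_fun => x.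
  by apply/differentiable_continuous/derivable1_diffP; have [] := du x.
split.
- move=> v; split.
  + exact: contm _ _ (is_derive_smooth c v).
  + exact: contm _ _ (is_derive_smooth1 c v).
  + exact: contm _ _ (is_derive_smooth2 c v).
- move=> v x vv; split; [|exact: S1|exact: S2].
  by rewrite ger0_norm ?Phi_ge0// (le_trans (Phi_le1 _))// KE; lra.
- move=> v x y vv; apply: (mean_value_norm (f := smooth c v) (df := smooth1 c v)) => z.
    exact: is_derive_smooth.
  by move=> _; exact: S1.
- exact: lip2.
- move=> v s x vv s0.
  have vpos u : v <= u -> 0 < u by move=> vu; rewrite (lt_le_trans v00)// (le_trans vv).
  have S2s u : v <= u <= v + s -> `|smooth2 c u x - smooth2 c v x| <= K * s.
    move=> /andP[vu us]; apply: (@le_trans _ _ (K * (u - v))).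
      apply: (mean_value_le (f := fun u => smooth2 c u x) vu).
        by move=> z /andP[vz _]; apply: is_derive_smooth2_variance; exact: vpos.
      by move=> z /andP[vz _]; apply: S2v; rewrite (le_trans vv).
    by rewrite ler_wpM2l//; lra.
  have vvs : v <= v + s by rewrite lerDl.
  have K0 : 0 <= K * s by rewrite mulr_ge0.
  pose f u := smooth c u x - 2^-1 * smooth2 c v x * u.
  have := @mean_value_le R f (fun u => 2^-1 * smooth2 c u x - 2^-1 * smooth2 c v x * 1)
    v (v + s) (K * s) vvs.
  have -> : f (v + s) - f v = smooth c (v + s) x - smooth c v x - s / 2 * smooth2 c v x.
    by rewrite /f; field.
  have -> : K * s * (v + s - v) = K * s ^+ 2 by ring.
  apply=> u /andP[vu us].
    exact: (is_derive_sub (is_derive_smooth_variance c x (vpos _ vu))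
      (is_derive_scale (2^-1 * smooth2 c v x) (is_derive_id u 1))).
  rewrite mulr1 -mulrBr normrM ger0_norm ?invr_ge0//.
  have := S2s u; rewrite vu us => /(_ isT); lra.
- move=> v a b z vv.
  (* The increment as a function of z has derivative r (b + z), where r is the
     first-order Taylor remainder of the first derivative at a. *)
  have r0 t : `|smooth1 c v (a + t) - smooth1 c v a - smooth2 c v a * t| <= K * `|t| * `|t|.
    pose f t := smooth1 c v (a + t) - smooth2 c v a * t.
    have := @mean_value_norm R f (fun t => smooth2 c v (a + t) * (0 + 1) - smooth2 c v a * 1)
      0 t (K * `|t|).
    rewrite /f addr0 mulr0 !subr0 addrAC; apply.
      move=> x; exact: (is_derive_sub (is_derive_chain (is_derive_smooth1 c v _)
        (is_derive_add (is_derive_cst a x 1) (is_derive_id x 1)))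
        (is_derive_scale (smooth2 c v a) (is_derive_id x 1))).
    move=> x; rewrite subr0 => xt; rewrite add0r !mulr1 (le_trans (lip2 _ _ _ vv))//.
    by rewrite addrC addKr ler_wpM2l.
  pose f t := smooth c v (a + b + t) - smooth1 c v a * t -
    smooth2 c v a * (b * t + 2^-1 * (t * t)).
  have := @mean_value_norm R f (fun t => smooth1 c v (a + b + t) * (0 + 1) -
     smooth1 c v a * 1 - smooth2 c v a * (b * 1 + 2^-1 * (1 * t + t * 1)))
     0 z (K * (`|b| + `|z|) ^+ 2).
  have -> : f z - f 0 = smooth c v (a + b + z) - smooth c v (a + b) -
      smooth1 c v a * z - smooth2 c v a * (b * z + z ^+ 2 / 2).
    by rewrite /f addr0; field.
  rewrite subr0 -mulrA; apply.
    move=> x; exact: (is_derive_sub (is_derive_sub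
      (is_derive_chain (is_derive_smooth c v _)
        (is_derive_add (is_derive_cst (a + b) x 1) (is_derive_id x 1)))
      (is_derive_scale (smooth1 c v a) (is_derive_id x 1)))
      (is_derive_scale (smooth2 c v a)
        (is_derive_add (is_derive_scale b (is_derive_id x 1))
          (is_derive_scale 2^-1
            (is_derive_mul (is_derive_id x 1) (is_derive_id x 1)))))).
  move=> x xz; rewrite subr0 in xz.
  have -> : smooth1 c v (a + b + x) * (0 + 1) - smooth1 c v a * 1 -
      smooth2 c v a * (b * 1 + 2^-1 * (1 * x + x * 1)) =
    smooth1 c v (a + (b + x)) - smooth1 c v a - smooth2 c v a * (b + x).
    by rewrite addrA; field.
  apply: le_trans (r0 _) _; rewrite -mulrA -expr2.
  rewrite ler_wpM2l// lerXn2r ?nnegrE ?addr_ge0//.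
  by rewrite (le_trans (ler_normD _ _))// lerD2l.
Qed.

(** Smoothing at variance d^2 approximates the indicator of the half-line, up to
    the Gaussian tails beyond h / d, outside a band of half-width h. *)
Lemma smooth_upper (c h d x : R) : 0 < d ->
  (x <= c - h)%R%:R <= smooth c (d ^+ 2) x + (1 - Phi (h / d)).
Proof.
move=> d0; rewrite /smooth sqrtr_sqr gtr0_norm//.
have := Phi_ge0 ((c - x) / d); have := Phi_le1 (h / d).
case: (leP x (c - h)) => xc /=; last by lra.
have : Phi (h / d) <= Phi ((c - x) / d).
  by apply: Phi_nondecreasing; rewrite ler_pM2r ?invr_gt0//; lra.
lra.
Qed.

Lemma smooth_lower (c h d x : R) : 0 < d ->
  smooth c (d ^+ 2) x <= (x <= c + h)%R%:R + Phi (- h / d).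
Proof.
move=> d0; rewrite /smooth sqrtr_sqr gtr0_norm//.
have := Phi_le1 ((c - x) / d); have := Phi_ge0 (- h / d).
case: (leP x (c + h)) => xc /=; first by lra.
have : Phi ((c - x) / d) <= Phi (- h / d).
  by apply: Phi_nondecreasing; rewrite ler_pM2r ?invr_gt0//; lra.
lra.
Qed.

End standard_normal.

(** * Central limit theorem for triangular arrays *)

Section window_lengths.
Context (R : realType).

Definition rsqrt (n : nat) : R := (Num.sqrt n%:R)^-1.

Lemma rsqrt_ge0 n : 0 <= rsqrt n.
Proof. by rewrite invr_ge0. Qed.

Lemma rsqrt_gt0 n : (0 < n)%N -> 0 < rsqrt n.
Proof. by move=> n0; rewrite invr_gt0 sqrtr_gt0 ltr0n. Qed.

Lemma mulr_rsqrt2 n : (0 < n)%N -> n%:R * rsqrt n ^+ 2 = 1.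
Proof. by move=> n0; rewrite exprVn sqr_sqrtr// mulfV// pnatr_eq0 -lt0n. Qed.

Lemma cvg_rsqrt : rsqrt n @[n --> \oo] --> (0 : R).
Proof.
apply/cvgrPdist_le => /= e e0; near=> n.
have n0 : (0 < n)%N by near: n; exists 1%N.
rewrite sub0r normrN ger0_norm ?rsqrt_ge0//.
rewrite -(@ler_pXn2r _ 2)// ?nnegrE ?rsqrt_ge0 ?(ltW e0)//.
rewrite -(ler_pM2l (_ : 0 < n%:R)) ?ltr0n// mulr_rsqrt2//.
rewrite -ler_pdivrMr ?exprn_gt0// ltW//.
near: n; exact: nbhs_infty_gtr.
Unshelve. all: by end_near. Qed.

Lemma cvg_powR_rsqrt (a : R) : 0 < a -> rsqrt n `^ a @[n --> \oo] --> (0 : R).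
Proof.
move=> a0; apply/cvgrPdist_le => /= e e0.
have ea0 : 0 < e `^ a^-1 by rewrite powR_gt0.
near=> n; rewrite sub0r normrN ger0_norm ?powR_ge0//.
have -> : e = (e `^ a^-1) `^ a.
  by rewrite -powRrM mulVf ?gt_eqF// powRr1// ltW.
rewrite (ge0_ler_powR (ltW a0)) ?nnegrE ?rsqrt_ge0 ?(ltW ea0)// ltW//.
near: n.
have /cvgrPdist_lt/(_ _ ea0) := cvg_rsqrt; apply: filterS => n /=.
by rewrite sub0r normrN ger0_norm ?rsqrt_ge0.
Unshelve. all: by end_near. Qed.

(** The length is of order n^(b/2) with 1/m < b < 1: l / n^(1/2) has order
    n^((b-1)/2), and n^(1/2) l^(-m) has order n^((1-bm)/2). *)
Lemma window_lengths (m : R) : 1 < m -> exists l : nat -> nat,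
  [/\ forall n, (0 < l n)%N,
      rsqrt n * (l n)%:R @[n --> \oo] --> (0 : R),
      (rsqrt n)^-1 * (l n)%:R `^ (- m) @[n --> \oo] --> (0 : R) &
      l n @[n --> \oo] --> \oo].
Proof.
move=> m1.
have m0 : 0 < m by exact: lt_trans m1.
pose b : R := (1 + m^-1) / 2.
have mV1 : m^-1 < 1 by rewrite invf_lt1.
have mV0 : 0 < m^-1 by rewrite invr_gt0.
have b1 : 0 < 1 - b by rewrite /b; lra.
have b0 : 0 < b by rewrite /b; lra.
have bm : 0 < b * m - 1.
  by rewrite /b mulrAC mulrDl mul1r mulVf ?gt_eqF//; lra.
pose l n := (Num.truncn (rsqrt n `^ b)^-1).+1.
have l_gt n : (rsqrt n `^ b)^-1 < (l n)%:R by exact: truncnS_gt.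
have l_le n : (l n)%:R <= (rsqrt n `^ b)^-1 + 1.
  rewrite /l -natr1 lerD2r; have := @truncn_le R (rsqrt n `^ b)^-1.
  by rewrite invr_ge0 powR_ge0.
exists l; split => //.
- apply: (@squeeze_cvgr _ _ _ _ (fun=> 0) (fun n => rsqrt n `^ (1 - b) + rsqrt n)).
  + near=> n; rewrite mulr_ge0 ?rsqrt_ge0//=.
    have n0 : (0 < n)%N by near: n; exists 1%N.
    have s0 := rsqrt_gt0 n0.
    rewrite powRB; last by rewrite (gt_eqF s0) implybT.
    by rewrite (powRr1 (ltW s0)) -[X in _ + X]mulr1 -mulrDr ler_wpM2l ?rsqrt_ge0.
  + exact: cvg_cst.
  + rewrite -[X in _ --> X]addr0; apply: cvgD; last exact: cvg_rsqrt.
    exact: cvg_powR_rsqrt.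
- apply: (@squeeze_cvgr _ _ _ _ (fun=> 0) (fun n => rsqrt n `^ (b * m - 1))).
  + near=> n; rewrite mulr_ge0 ?invr_ge0 ?rsqrt_ge0 ?powR_ge0//=.
    have n0 : (0 < n)%N by near: n; exists 1%N.
    have s0 := rsqrt_gt0 n0.
    rewrite powRB; last by rewrite (gt_eqF s0) implybT.
    have si : 0 < (rsqrt n)^-1 by rewrite (invr_gt0 (rsqrt n)).
    rewrite (powRr1 (ltW s0)) mulrC (ler_pM2r si).
    have z0 : 0 < rsqrt n `^ b by rewrite powR_gt0.
    have l0 : 0 < (l n)%:R `^ m :> R by rewrite powR_gt0 ?ltr0n.
    rewrite powRN powRrM -(ler_pM2r l0) mulVf ?gt_eqF// -powRM ?powR_ge0//.
    rewrite -[leLHS](congr1 (fun f => f m) (powR1 R)).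
    rewrite (ge0_ler_powR (ltW m0)) ?nnegrE ?mulr_ge0 ?powR_ge0// ltW// mulrC.
    by rewrite -ltr_pdivrMr// mul1r.
  + exact: cvg_cst.
  + exact: cvg_powR_rsqrt.
- apply/cvgnyPge => N.
  have N0 : 0 < (N.+1%:R : R)^-1 by rewrite invr_gt0.
  have /cvgrPdist_lt/(_ _ N0) h := cvg_powR_rsqrt b0.
  near=> n.
  have n0 : (0 < n)%N by near: n; exists 1%N.
  have z0 : 0 < rsqrt n `^ b by rewrite powR_gt0 ?rsqrt_gt0.
  have zN : rsqrt n `^ b < N.+1%:R^-1.
    suff : `|0 - rsqrt n `^ b| < N.+1%:R^-1.
      by rewrite sub0r normrN ger0_norm ?powR_ge0.
    by near: n; exact: h.
  rewrite -(ler_nat R) ltW// (lt_trans _ (l_gt n))//.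
  rewrite (@lt_trans _ _ N.+1%:R) ?ltr_nat//.
  by rewrite -[ltLHS]invrK ltf_pV2 ?posrE ?invr_gt0.
Unshelve. all: by end_near. Qed.

End window_lengths.

Arguments rsqrt {R} n.

Section real_inequalities.
Context (R : realType).

Lemma indic_le (a b c : R) : b <= c -> (a <= b)%R%:R <= (a <= c)%R%:R :> R.
Proof. by move=> bc; rewrite ler_nat; case: leP => //= /le_trans ->. Qed.

Lemma within_band (a b eta : R) : `|a - b| <= eta ->
  b <= a + 2 * eta - eta /\ a - 2 * eta + eta <= b.
Proof. by rewrite ler_norml => /andP[? ?]; split; lra. Qed.

Lemma weighted_upper (c b s a eps : R) : 0 <= c <= 1 -> b <= 1 -> 0 <= eps ->
  1 - a <= eps -> b <= s + (1 - a) -> b <= 1 - c + c * s + eps.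
Proof.
move=> /andP[c0 c1] b1 e0 ae bs.
have k1 : 0 <= (1 - c) * (1 - b) by rewrite mulr_ge0// subr_ge0.
have k2 : 0 <= c * (s + eps - b) by rewrite mulr_ge0//; lra.
have k3 : 0 <= (1 - c) * eps by rewrite mulr_ge0 ?subr_ge0.
by lra.
Qed.

Lemma weighted_lower (c b s a eps : R) : c <= 1 -> 0 <= s ->
  a <= eps -> s <= b + a -> c * s <= b + eps.
Proof.
move=> c1 s0 ae bs.
have k1 : 0 <= (1 - c) * s by rewrite mulr_ge0// subr_ge0.
by lra.
Qed.

(** E, B, Iu and Il are the mean weight, the probability to be estimated and the
    two smoothed means; u, l and p are values of the normal distribution
    function. *)
Lemma sandwich_conclusion (E B Iu Il u l p eps : R) : E <= 1 -> 0 <= u -> l <= 1 ->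
  1 - eps <= E -> u <= p + eps -> p - eps <= l ->
  `|E * u - Iu| <= eps -> `|E * l - Il| <= eps ->
  B <= 1 - E + Iu + eps -> Il <= B + eps -> `|p - B| <= 4 * eps.
Proof.
move=> E1 u0 l1 Ee up lp; rewrite !ler_norml => /andP[un1 un2] /andP[ln1 ln2].
have k1 : 0 <= (1 - E) * u by rewrite mulr_ge0// subr_ge0.
have k2 : 0 <= (1 - E) * (1 - l) by rewrite mulr_ge0// subr_ge0.
by move=> BI IB; apply/andP; split; lra.
Qed.

End real_inequalities.

(** The error of the Lindeberg theorem as a polynomial in the four quantities
    s = n^(-1/2), x = s l, y = n^(1/2) l^(-m) and t, the error on the variance. *)
Definition error_polynomial (R : realType) (K D C v s x y t : R) : R :=
  let W := 1 + 2 * D * (C + 2 * (x * y)) in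
  K * (D * (2 * y)) +
  (2 * (K * (D * (2 * (x * y)))) + K * (D * (2 * (s * y))) / 2 + K * t / 2) +
  (4 * K * x * W + v * K / 2 * (s * W) +
   (2 * K * s + K * v ^+ 2 * (s * s) + v * K / 4 * x)) + K * (3 * x) +
  (K * (3 * (s * x) * v) / 2 + K * (3 * (s * x) * v * (3 * (s * x) * v))).

Lemma cvg_error_polynomial (R : realType) (K D C v : R) (s x y t : nat -> R) :
  s n @[n --> \oo] --> (0 : R) -> x n @[n --> \oo] --> (0 : R) ->
  y n @[n --> \oo] --> (0 : R) -> t n @[n --> \oo] --> (0 : R) ->
  error_polynomial K D C v (s n) (x n) (y n) (t n) @[n --> \oo] --> (0 : R).
Proof.
move=> s0 x0 y0 t0.
have -> : (0 : R) = error_polynomial K D C v 0 0 0 0.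
  by rewrite /error_polynomial /=; ring.
rewrite /error_polynomial /=.
repeat lazymatch goal with
  | |- _ --> (_ + _)%R => apply: cvgD
  | |- _ --> (_ * _)%R => apply: cvgM
  | |- _ --> 0%R => first [exact: s0|exact: x0|exact: y0|exact: t0]
  | |- _ --> _ => exact: cvg_cst
  end.
Qed.

(** The half-width of the band is eta and the standard deviation of the
    smoothing is eta^2, so that the band, the smoothing and the Gaussian tails
    beyond eta / eta^2 all vanish with eta. *)
Lemma smoothing_parameter (R : realType) (dd v eps : R) : 0 < v -> 0 < eps ->
  let p (eta sg : R) := (dd + sg * (2 * eta)) / Num.sqrt (eta ^+ 4 + v) in
  exists2 eta : R, 0 < eta & [/\ Phi (- eta / eta ^+ 2) <= eps,
    1 - Phi (eta / eta ^+ 2) <= eps,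
    Phi (p eta 1) <= Phi (dd / Num.sqrt v) + eps &
    Phi (dd / Num.sqrt v) - eps <= Phi (p eta (-1))].
Proof.
move=> v0 eps0 p.
have cinv : (eta / eta ^+ 2) @[eta --> (0 : R)^'+] --> +oo.
  apply/cvgryPge => A; near=> eta.
  have eta0 : 0 < eta by near: eta; exact: nbhs_right_gt.
  have -> : eta / eta ^+ 2 = eta^-1 by field; rewrite gt_eqF.
  have B0 : 0 < `|A| + 1 by rewrite ltr_wpDl.
  have etaB : eta < (`|A| + 1)^-1 by near: eta; apply: nbhs_right_lt; rewrite invr_gt0.
  apply: (@le_trans _ _ (`|A| + 1)); first by rewrite ler_wpDr// ler_norm.
  by rewrite -[leLHS]invrK lef_pV2 ?posrE ?invr_gt0// ltW.
have cninv : (- eta / eta ^+ 2) @[eta --> (0 : R)^'+] --> -oo.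
  rewrite (_ : (fun eta : R => - eta / eta ^+ 2) = - (fun eta => eta / eta ^+ 2)).
    exact/cvgNrNy.
  by apply/funext => eta /=; rewrite mulNr.
have cp sg : Phi (p eta sg) @[eta --> (0 : R)^'+] --> Phi (dd / Num.sqrt v).
  apply: continuous_cvg; first exact: continuous_Phi.
  apply: cvg_at_right_filter; rewrite /p.
  have -> : dd / Num.sqrt v = (dd + sg * (2 * 0)) / Num.sqrt (0 ^+ 4 + v).
    by rewrite !mulr0 addr0 expr0n/= add0r.
  apply: cvgM.
    apply: cvgD; first exact: cvg_cst.
    apply: cvgM; first exact: cvg_cst.
    by apply: cvgM; [exact: cvg_cst|exact: cvg_id].
  apply: cvgV; first by rewrite expr0n/= add0r gt_eqF// sqrtr_gt0.
  apply: continuous_cvg; first exact: sqrt_continuous.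
  by apply: cvgD; [exact: exprn_continuous|exact: cvg_cst].
have /cvgrPdist_le/(_ _ eps0) h1 := cvg_comp _ _ cninv (@cvg_PhiNy R).
have /cvgrPdist_le/(_ _ eps0) h2 := cvg_comp _ _ cinv (@cvg_Phiy R).
have /cvgrPdist_le/(_ _ eps0) h3 := cp 1.
have /cvgrPdist_le/(_ _ eps0) h4 := cp (-1).
have h5 := nbhs_right_gt (0 : R).
have [eta [[[[n1 n2] n3] n4] n5]] := filter_ex
  (filterI (filterI (filterI (filterI h1 h2) h3) h4) h5).
exists eta => //; move: n1 n2 n3 n4 => /=; rewrite !ler_distl.
move=> /andP[n1 _] /andP[_ n2] /andP[n3 _] /andP[_ n4].
by split; [rewrite -subr_le0|rewrite lerBlDl|rewrite -lerBlDr|rewrite lerBlDr].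
Unshelve. all: by end_near. Qed.

Section triangular_clt.
Context dO (Omega : measurableType dO) d (S : measurableType d) (R : realType).
Variable Pr : probability Omega R.
Variable X : nat -> {RV Pr >-> S}.
Variables (P : R.-pker S ~> S) (pi : probability S R).
Hypothesis XP : markov_chain P X.
Variables (M : S -> R) (m : R) (m1 : 1 < m).
Hypotheses (mM : measurable_fun setT M) (M0 : forall x, 0 <= M x).
Hypothesis iM : (\int[pi]_x (M x)%:E < +oo)%E.
Hypothesis TVM : forall (x : S) (n : nat), (0 < n)%N ->
  (Defs.total_variation (nstep P n x) pi <= (M x * n%:R `^ (- m))%:E)%E.
Variables (h : nat -> S -> R).
Hypotheses (mh : forall n, measurable_fun setT (h n)).
Hypotheses (h1 : forall n x, `|h n x| <= 1).
Hypothesis pih : forall n, \int[pi]_x h n x = 0.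
Variables (sigma2 : R) (l : nat -> nat).
Hypothesis sigma2_gt0 : 0 < sigma2.
Hypothesis l_gt0 : forall n, (0 < l n)%N.
Hypothesis l_small : rsqrt n * (l n)%:R @[n --> \oo] --> (0 : R).
Hypothesis l_large : (rsqrt n)^-1 * (l n)%:R `^ (- m) @[n --> \oo] --> (0 : R).
Hypothesis l_variance :
  truncated_variance P pi (h n) (l n) @[n --> \oo] --> sigma2.

Let Pr1 : Pr setT = 1%E. Proof. exact: probability_setT. Qed.
Let sigma2_ge0 : 0 <= sigma2. Proof. exact: ltW. Qed.

Let A n : Omega -> R := partial_sum X (h n) (rsqrt n) n.

Let bh n : bmf (h n). Proof. exact: bmf_le (h1 n). Qed.

Let bA n : bmf (A n).
Proof. by apply: bmfZ; apply: bmf_sum => i; apply: bmf_comp. Qed.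

(** The bound of the Lindeberg theorem for l = l n is the polynomial above, as
    n s^2 = 1 turns n s l^(-m) into y and l^(1-m) into x y. *)
Lemma cvg_smooth_mean (K0 v0 K : R) (U U1 U2 : R -> R -> R) : 0 <= K0 ->
  heat_test v0 K U U1 U2 ->
  \int[Pr]_w (\1_(small_start X M K0) w * U v0 (A n w)) @[n --> \oo] -->
  \int[Pr]_w \1_(small_start X M K0) w * U (v0 + sigma2) 0.
Proof.
move=> K00 UK; have [C C0 rC] := power_sum_bounded m1.
set e := \1_(small_start X M K0).
pose D := mixing_constant pi M K0.
pose x n : R := rsqrt n * (l n)%:R.
pose y n : R := (rsqrt n)^-1 * (l n)%:R `^ (- m).
pose t n : R := `|truncated_variance P pi (h n) (l n) - sigma2|.
have t0 : t n @[n --> \oo] --> (0 : R).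
  rewrite -[X in _ --> X](normr0 R) -(subrr sigma2).
  by apply: cvg_norm; apply: cvgB => //; exact: cvg_cst.
pose E n : R := error_polynomial K D C sigma2 (rsqrt n) (x n) (y n) (t n).
have bound n : (0 < n)%N -> (3 * l n <= n)%N ->
    `|\int[Pr]_w (e w * U v0 (A n w)) - \int[Pr]_w e w * U (v0 + sigma2) 0| <= E n.
  move=> n0 ln.
  have := lindeberg XP m1 mM M0 iM TVM rC K00 (mh n) (h1 n) (pih n) UK
    sigma2_ge0 (l_gt0 n) ln (erefl _).
  rewrite -/(rsqrt n) -/(A n) -/e => /le_trans; apply.
  have s0 := rsqrt_gt0 R n0.
  rewrite le_eqVlt; apply/orP; left; apply/eqP.
  rewrite /lindeberg_error -/(t n) -/D /E /error_polynomial /x /y /=.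
  have -> : n%:R = (rsqrt n ^+ 2)^-1 :> R.
    have s2 : rsqrt n ^+ 2 != 0 :> R by rewrite expf_neq0// gt_eqF.
    by apply: (mulIf s2); rewrite mulr_rsqrt2// mulVf.
  rewrite natrM; move: (_ `^ _) => rho; field.
  by rewrite gt_eqF//= pnatr_eq0 -lt0n.
have E0 : E n @[n --> \oo] --> (0 : R).
  exact: cvg_error_polynomial (@cvg_rsqrt R) l_small l_large t0.
apply/cvgrPdist_le => /= eps eps0.
have /cvgrPdist_le/(_ _ eps0) E1 := E0.
have /cvgrPdist_le/(_ (3^-1) _) x1 := l_small.
near=> n; rewrite distrC; apply: le_trans (bound n _ _) _.
- by near: n; exists 1%N.
- have n0 : (0 < n)%N by near: n; exists 1%N.
  have xn : `|0 - x n| <= 3^-1 by near: n; apply: x1; rewrite invr_gt0.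
  have s1 : rsqrt n <= 1 :> R.
    by rewrite /rsqrt invf_le1 ?sqrtr_gt0 ?ltr0n// -[leLHS]sqrtr1 ler_sqrt ?ler0n// ler1n.
  rewrite sub0r normrN ger0_norm in xn; last by rewrite mulr_ge0 ?rsqrt_ge0.
  rewrite -(ler_nat R) natrM -(ler_pM2l (rsqrt_gt0 R n0)) mulrCA.
  apply: (@le_trans _ _ 1); first by move: xn; rewrite -/(x n); lra.
  have s0 := rsqrt_gt0 R n0.
  rewrite -(ler_pM2l s0) mulr1 mulrA -expr2 mulrC mulr_rsqrt2//.
- apply: le_trans (ler_norm _) _.
  suff : `|0 - E n| <= eps by rewrite sub0r normrN.
  by near: n; exact: E1.
Unshelve. all: by end_near. Qed.

(** The events increase to the sample space with K, as M is finite. *)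
Lemma small_start_exhausts (eps : R) : 0 < eps -> exists2 K0, 0 <= K0 &
  1 - eps <= \int[Pr]_w \1_(small_start X M K0) w.
Proof.
move=> eps0.
have cv : Pr (small_start X M n%:R) @[n --> \oo] --> (1%E : \bar R).
  rewrite -Pr1 (_ : setT = \bigcup_n small_start X M n%:R).
    apply: nondecreasing_cvg_mu.
    - by move=> n; exact: measurable_small_start.
    - by apply: bigcup_measurable => n _; exact: measurable_small_start.
    - move=> a b ab; apply/subsetPset => w /= /le_trans; apply.
      by rewrite ler_nat.
  apply/seteqP; split => // w _; exists (Num.truncn (M (X 0%N w))).+1 => //=.
  by rewrite /small_start/= ltW// truncnS_gt.
have /fine_cvgP[_ /cvgrPdist_le/(_ _ eps0)] := cv.
move=> [N _ /(_ N (leqnn N))] /= H.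
exists N%:R => //; rewrite mean_indic; last exact: measurable_small_start.
by move: H; rewrite ler_norml => /andP[_]; lra.
Qed.

(** The indicator of A_n <= d_n lies between the smoothed indicators of A_n <= c
    for c = d - 2 eta and c = d + 2 eta: of the distance 2 eta, one half absorbs
    d_n - d and the other is the band of the smoothing. *)
Theorem triangular_clt (dn : nat -> R) (dd : R) : dn n @[n --> \oo] --> dd ->
  fine (Pr [set w | A n w <= dn n]) @[n --> \oo] --> Phi (dd / Num.sqrt sigma2).
Proof.
move=> cdn; apply/cvgrPdist_le => /= eps eps0.
pose e1 := eps / 4; have e10 : 0 < e1 by rewrite divr_gt0.
pose p eta sg : R := (dd + sg * (2 * eta)) / Num.sqrt (eta ^+ 4 + sigma2).
have near_eta : exists2 eta : R, 0 < eta & [/\ Phi (- eta / eta ^+ 2) <= e1,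
    1 - Phi (eta / eta ^+ 2) <= e1,
    Phi (p eta 1) <= Phi (dd / Num.sqrt sigma2) + e1 &
    Phi (dd / Num.sqrt sigma2) - e1 <= Phi (p eta (-1))].
  exact: smoothing_parameter.
have [eta eta0 [t1 t2 p1 p2]] := near_eta.
have [K0 K00 eK0] := small_start_exhausts e10.
pose e w : R := \1_(small_start X M K0) w.
have be : bmf e by apply: bmf_indic; exact: measurable_small_start.
have e_ge0 w : 0 <= e w by rewrite /e indicE.
have e_le1 w : e w <= 1 by rewrite /e indicE; case: (_ \in _).
have Ee1 : \int[Pr]_w e w <= 1.
  by rewrite -[leRHS](mean_cst Pr1) le_mean//; exact: bmf_cst.
have d0 : 0 < eta ^+ 2 by rewrite exprn_gt0.
have v0 : 0 < (eta ^+ 2) ^+ 2 by rewrite exprn_gt0.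
have cu := cvg_smooth_mean K00 (heat_test_smooth (dd + 2 * eta) v0).
have cl := cvg_smooth_mean K00 (heat_test_smooth (dd - 2 * eta) v0).
have /cvgrPdist_le/(_ _ e10) cu1 := cu.
have /cvgrPdist_le/(_ _ e10) cl1 := cl.
have /cvgrPdist_le/(_ _ eta0) cdn1 := cdn.
have bU c n : bmf (fun w => e w * smooth c ((eta ^+ 2) ^+ 2) (A n w)).
  apply: bmfM => //; apply: (@bmf_le _ _ _ _ 1).
    have [mS _ _] := heat_test_measurable (heat_test_smooth c v0) ((eta ^+ 2) ^+ 2).
    by apply: measurableT_comp => //; exact: (bA n).1.
  by move=> w; rewrite ger0_norm ?Phi_ge0// Phi_le1.
apply: filterS (filterI (filterI cu1 cl1) cdn1) => n /= [[un ln] dnn].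
pose B := [set w | A n w <= dn n].
have mB : measurable B.
  rewrite (_ : B = A n @^-1` `]-oo, dn n]%classic).
    by rewrite -[X in measurable X]setTI; exact: (bA n).1.
  by apply/seteqP; split => w /=; rewrite in_itv.
have bB : bmf (\1_B : Omega -> R) by exact: bmf_indic.
rewrite -(mean_indic Pr mB).
have BE w : \1_B w = (A n w <= dn n)%R%:R :> R.
  by rewrite indicE; congr (nat_of_bool _)%:R; apply/idP/idP; rewrite inE.
have [dn_le le_dn] := within_band dnn.
have upper : \int[Pr]_w \1_B w <= (1 - \int[Pr]_w e w) +
    \int[Pr]_w (e w * smooth (dd + 2 * eta) ((eta ^+ 2) ^+ 2) (A n w)) + e1.
  rewrite -[X in X - _](mean_cst Pr1 1) -[X in _ + X](mean_cst Pr1).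
  rewrite -(meanB Pr1)//; last exact: bmf_cst.
  rewrite -(meanD Pr1)//; last by apply: bmfB => //; exact: bmf_cst.
  rewrite -(meanD Pr1); last 2 first.
  - by apply: bmfD => //; apply: bmfB => //; exact: bmf_cst.
  - exact: bmf_cst.
  apply: le_mean => //.
    apply: bmfD; last exact: bmf_cst.
    by apply: bmfD => //; apply: bmfB => //; exact: bmf_cst.
  move=> w; rewrite BE.
  apply: (weighted_upper _ _ (ltW e10) t2); rewrite ?e_ge0 ?e_le1//.
    by rewrite lern1 leq_b1.
  apply: le_trans (smooth_upper (dd + 2 * eta) eta (A n w) d0).
  by apply: indic_le; exact: dn_le.
have lower : \int[Pr]_w (e w * smooth (dd - 2 * eta) ((eta ^+ 2) ^+ 2) (A n w))
    <= \int[Pr]_w \1_B w + e1.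
  rewrite -[X in _ <= _ + X](mean_cst Pr1) -(meanD Pr1)//; last exact: bmf_cst.
  apply: le_mean => //; first by apply: bmfD => //; exact: bmf_cst.
  move=> w; rewrite BE.
  apply: (weighted_lower _ (Phi_ge0 _) t1); first exact: e_le1.
  apply: le_trans (smooth_lower (dd - 2 * eta) eta (A n w) d0) _.
  by rewrite lerD2r; apply: indic_le; exact: le_dn.
have sE sg : smooth (dd + sg * (2 * eta)) ((eta ^+ 2) ^+ 2 + sigma2) 0 = Phi (p eta sg).
  by rewrite /smooth /p subr0 -exprM.
have := sE 1; have := sE (-1); rewrite mul1r mulN1r => sl su.
rewrite su in un; rewrite sl in ln.
have -> : eps = 4 * e1 by rewrite /e1 mulrC divfK.
exact: (sandwich_conclusion Ee1 (Phi_ge0 _) (Phi_le1 _) eK0 p1 p2 un ln upper lower).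
Qed.

End triangular_clt.

(** * Covariances of indicators *)

Lemma covariance_mean d (T : measurableType d) (R : realType)
    (mu : probability T R) (f g : T -> R) :
  fine (covariance mu f g) =
  \int[mu]_x ((f x - \int[mu]_y f y) * (g x - \int[mu]_y g y)).
Proof. by rewrite !unlock. Qed.

Section pair_law_mean.
Context d (S : measurableType d) (R : realType).
Variables (pi : probability S R) (K : R.-pker S ~> S).

Let pi1 : pi setT = 1%E. Proof. exact: probability_setT. Qed.
Let nu : {measure set (S * S) -> \bar R} := pair_law pi K.
Let nu1 : nu setT = 1%E.
Proof. exact: (@probability_setT _ _ _ (pair_law pi K)). Qed.

(** Two reductions to indicators, in f and then in g, leave the measure of a
    rectangle. *)
Lemma mean_pair_law (f g : S -> R) : bmf f -> bmf g ->
  \int[nu]_z (f z.1 * g z.2) = \int[pi]_x (f x * kmean K g x).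
Proof.
have b1 (u : S -> R) : bmf u -> bmf (fun z : S * S => u z.1).
  by move=> bu; exact: bmf_comp.
have b2 (u : S -> R) : bmf u -> bmf (fun z : S * S => u z.2).
  by move=> bu; exact: bmf_comp.
have bK (u : S -> R) : bmf u -> bmf (kmean K u) by exact: bmf_kmean.
have bp (u v : S -> R) : bmf u -> bmf v -> bmf (fun z : S * S => u z.1 * v z.2).
  by move=> bu bv; apply: bmfM; [exact: b1|exact: b2].
have diff_bound (u v : S -> R) (a b : R) : bmf u -> bmf v -> 0 <= a -> 0 <= b ->
    (forall x, `|u x| <= a) -> (forall x, `|v x| <= b) ->
    `|\int[nu]_z (u z.1 * v z.2) - \int[pi]_x (u x * kmean K v x)| <= 2 * a * b.
  move=> bu bv a0 b0 ua vb; rewrite -mulrA mulr_natl mulr2n.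
  apply: le_trans (ler_normB _ _) _; apply: lerD; apply: norm_mean_bound => //.
  - exact: bp.
  - by move=> z; rewrite normrM ler_pM.
  - by apply: bmfM => //; exact: bK.
  - by move=> z; rewrite normrM ler_pM// kmean_bound.
move=> bf bg; apply/eqP; rewrite -subr_eq0; apply/eqP.
have [_ [b gb]] := bg.
have b0 : 0 <= b by rewrite (le_trans _ (gb point)).
apply: (@functional_vanish _ _ _ (fun f => \int[nu]_z (f z.1 * g z.2) -
  \int[pi]_x (f x * kmean K g x)) (2 * b)) => //.
- move=> u v bu bv; have bKg := bK _ bg.
  under eq_Rintegral do rewrite mulrDl.
  under [X in _ - X]eq_Rintegral do rewrite mulrDl.
  by rewrite (meanD nu1) ?(meanD pi1); [ring|exact: bmfM..|exact: bp|exact: bp].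
- move=> a u bu; have bKg := bK _ bg.
  under eq_Rintegral do rewrite -mulrA.
  under [X in _ - X]eq_Rintegral do rewrite -mulrA.
  by rewrite (meanZ nu1) ?(meanZ pi1); [ring|exact: bmfM|exact: bp].
- move=> u a bu ua; rewrite mulrAC; apply: diff_bound => //.
  by rewrite (le_trans _ (ua point)).
move=> a; have := measurable_superlevel a bf.1; set A := mkset _ => mA.
have bA : bmf (\1_A : S -> R) by exact: bmf_indic.
apply: (@functional_vanish _ _ _ (fun g => \int[nu]_z (\1_A z.1 * g z.2) -
  \int[pi]_x (\1_A x * kmean K g x)) 2) => //.
- move=> u v bu bv; have bKu := bK _ bu; have bKv := bK _ bv.
  under eq_Rintegral do rewrite mulrDr.
  rewrite kmeanD//; under [X in _ - X]eq_Rintegral do rewrite mulrDr.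
  by rewrite (meanD nu1) ?(meanD pi1); [ring|exact: bmfM..|exact: bp|exact: bp].
- move=> c u bu; have bKu := bK _ bu.
  under eq_Rintegral do rewrite mulrCA.
  rewrite kmeanZ//; under [X in _ - X]eq_Rintegral do rewrite mulrCA.
  by rewrite (meanZ nu1) ?(meanZ pi1); [ring|exact: bmfM|exact: bp].
- move=> u c bu uc; rewrite -[2]mulr1; apply: diff_bound => //.
    by rewrite (le_trans _ (uc point)).
  by move=> x; rewrite indicE; case: (_ \in _); rewrite ?normr1 ?normr0.
move=> c; have := measurable_superlevel c bg.1; set B := mkset _ => mB.
apply/eqP; rewrite subr_eq0; apply/eqP.
rewrite (eq_Rintegral _ (g := \1_(A `*` B))); last first.
  by move=> z _; rewrite !indicE -natrM mulnb in_setX.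
rewrite mean_indic; last exact: measurableX.
congr fine; apply: eq_integral => x _.
rewrite kmean_indic// indicE; case: (boolP (x \in A)) => xA.
  by rewrite in_xsectionX// mul1r fineK// fin_kernel.
by rewrite notin_xsectionX// measure0 mul0r.
Qed.

End pair_law_mean.

Lemma affine_distance (R : realType) (a b c e n I : R) :
  `|a - b| <= 2 * I -> `|c - e| <= n * (2 * I) ->
  `|a + 2 * c - (b + 2 * e)| <= (2 + 4 * n) * I.
Proof.
move=> ab ce; have -> : a + 2 * c - (b + 2 * e) = (a - b) + 2 * (c - e) by ring.
have -> : (2 + 4 * n) * I = 2 * I + 2 * (n * (2 * I)) by ring.
apply: le_trans (ler_normD _ _) _; apply: lerD => //.
by rewrite normrM ger0_norm// ler_wpM2l.
Qed.

Section autocov_perturbation.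
Context d (S : measurableType d) (R : realType).
Variables (P : R.-pker S ~> S) (pi : probability S R).
Hypothesis Ppi : invariant_distribution P pi.

Let pi1 : pi setT = 1%E. Proof. exact: probability_setT. Qed.

(** h P^n h - k P^n k = (h - k) P^n h + k P^n (h - k), and by invariance P^n does
    not increase the mean of |h - k|. *)
Lemma autocov_lipschitz (h k : S -> R) (n : nat) : bmf h -> bmf k ->
  (forall x, `|h x| <= 1) -> (forall x, `|k x| <= 1) ->
  `|autocov P pi h n - autocov P pi k n| <= 2 * \int[pi]_x `|h x - k x|.
Proof.
move=> bh bk h1 k1; pose D x := h x - k x.
have bD : bmf D by exact: bmfB.
have bK (u : S -> R) : bmf u -> bmf (kmean (nstep P n) u) by exact: bmf_kmean.
have bn := bmf_norm bD.
have -> : autocov P pi h n - autocov P pi k n =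
    \int[pi]_x (D x * kmean (nstep P n) h x + k x * kmean (nstep P n) D x).
  rewrite /autocov -(meanB pi1); [|by apply: bmfM => //; exact: bK..].
  apply: eq_Rintegral => x _.
  rewrite (_ : kmean (nstep P n) D x = kmean (nstep P n) h x - kmean (nstep P n) k x).
    by rewrite /D; ring.
  by rewrite /kmean -meanB//; exact: prob_kernel.
apply: (@le_trans _ _ (\int[pi]_x (`|D x| + kmean (nstep P n) (fun y => `|D y|) x))).
  apply: norm_mean_le => //.
  - by apply: bmfD; apply: bmfM => //; exact: bK.
  - by apply: bmfD => //; exact: bK.
  - move=> x; rewrite (le_trans (ler_normD _ _))// !normrM lerD//.
      by rewrite ler_piMr// kmean_bound.
    apply: (@le_trans _ _ `|kmean (nstep P n) D x|); first by rewrite ler_piMl.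
    by apply: norm_mean => //; exact: prob_kernel.
rewrite (meanD pi1)//; last exact: bK.
by rewrite mean_invariant_nstep// mulr_natl mulr2n.
Qed.

Lemma truncated_variance_lipschitz (h k : S -> R) (l : nat) : bmf h -> bmf k ->
  (forall x, `|h x| <= 1) -> (forall x, `|k x| <= 1) ->
  `|truncated_variance P pi h l - truncated_variance P pi k l| <=
  (2 + 4 * l%:R) * \int[pi]_x `|h x - k x|.
Proof.
move=> bh bk h1 k1; have L n := autocov_lipschitz n bh bk h1 k1.
set I := \int[pi]_x _ in L *.
have S2 : `|\sum_(1 <= n < l.+1) autocov P pi h n - \sum_(1 <= n < l.+1) autocov P pi k n|
    <= l%:R * (2 * I).
  rewrite -sumrB (le_trans (ler_norm_sum _ _ _))//.
  rewrite (le_trans (ler_sum _ (fun n _ => L n)))//.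
  by rewrite big_const_nat subSS subn0 iter_addr_0 -[X in X <= _]mulr_natl.
exact: affine_distance (L 0%N) S2.
Qed.

End autocov_perturbation.

(** * Order statistics *)

Lemma nth_sort_le (R : realType) (s : seq R) (j : nat) (x : R) : (j < size s)%N ->
  (nth 0 (sort <=%O s) j <= x) = (j < count (fun y : R => (y <= x)%R) s)%N.
Proof.
move=> js; have ss : sorted <=%O (sort <=%O s) by exact: sort_le_sorted.
have -> : count (fun y : R => (y <= x)%R) s =
    count (fun y : R => (y <= x)%R) (sort <=%O s).
  by apply/esym/permP; rewrite perm_sort.
apply/idP/idP => [|jc]; last exact: nth_count_le.
apply: contraLR; rewrite -leqNgt -ltNge => cj.
by apply: nth_count_gt => //; rewrite cj size_sort.
Qed.

(** * The quantile of a continuous distribution *)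

Section quantile_density.
Context d (S : measurableType d) (R : realType).
Variables (pi : probability S R) (g : {RV pi >-> R}) (f : R -> R).
Hypothesis gf : continuous_density g f.

Let pi1 : pi setT = 1%E. Proof. exact: probability_setT. Qed.

Definition real_cdf (v : R) : R := fine (cdf g v).

Let real_cdfE v : (real_cdf v)%:E = cdf g v.
Proof. by rewrite fineK// fin_num_measure. Qed.

Let real_cdf_le u v : u <= v -> real_cdf u <= real_cdf v.
Proof. by move=> uv; rewrite -lee_fin !real_cdfE; exact: cdf_nondecreasing. Qed.

Lemma is_derive_real_cdf (v : R) : is_derive v 1 real_cdf (f v).
Proof.
have [f0 cf fE] := gf.
have -> : real_cdf = fun v => \int[lebesgue_measure]_(t in `]-oo, v]) f t.
  by apply/funext => u; rewrite /real_cdf fE.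
apply: is_derive_lower_integral => // y; apply/integrableP; split.
  apply/measurable_EFinP; apply: measurable_funTS.
  exact: continuous_measurable_fun.
under eq_integral do rewrite /= ger0_norm//.
by rewrite -fE -real_cdfE ltry.
Qed.

Let real_cdf_continuous : continuous real_cdf.
Proof.
move=> v; apply/differentiable_continuous/derivable1_diffP.
by have [] := is_derive_real_cdf v.
Qed.

(** The density being continuous at v, the derivative of F(u) - f(v) u is small
    near v. *)
Lemma real_cdf_expansion (v eps : R) : 0 < eps ->
  \forall t \near (0 : R), `|real_cdf (v + t) - real_cdf v - f v * t| <= eps * `|t|.
Proof.
move=> eps0; have [_ cf _] := gf.
have /cvgrPdist_le/(_ _ eps0)/nbhs_ballP[r /= r0 fr] := cf v.
apply/nbhs_ballP; exists r => //= t; rewrite /ball/= sub0r normrN => tr.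
pose k u := real_cdf u - f v * u.
have dk (u : R) : is_derive u 1 k (f u - f v * 1).
  exact: (is_derive_sub (is_derive_real_cdf u) (is_derive_scale (f v) (is_derive_id u 1))).
have := @mean_value_norm R k _ v (v + t) eps dk.
have -> : k (v + t) - k v = real_cdf (v + t) - real_cdf v - f v * t by rewrite /k; ring.
rewrite addrC addKr; apply => u ut.
rewrite mulr1 distrC; apply: fr; rewrite /ball/= distrC.
exact: le_lt_trans tr.
Qed.

(** By continuity F cannot jump over q at the infimum. *)
Lemma real_cdf_quantile (q : R) : 0 < q < 1 -> real_cdf (quantile g q) = q.
Proof.
move=> /andP[q0 q1]; set xi := quantile g q.
pose A : set R := [set v | q <= real_cdf v].
have xiE : xi = inf A.
  by congr inf; apply/seteqP; split => v /=; rewrite -real_cdfE lee_fin.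
have near_xi e : 0 < e -> \forall v \near xi, `|real_cdf xi - real_cdf v| < e.
  by move=> e0; have /cvgrPdist_lt/(_ _ e0) := @real_cdf_continuous xi.
have A0 : A !=set0.
  have /fine_cvgP[_ /cvgrPdist_lt/(_ (1 - q))] := cvg_cdfy1 g.
  rewrite subr_gt0 => /(_ q1)[B [_ B1]]; exists (B + 1).
  have : `|1 - real_cdf (B + 1)| < 1 - q by apply: B1; rewrite ltrDl.
  by rewrite ltr_norml /A/= => /andP[_]; move: (real_cdf _) => z; lra.
have hA : has_lbound A.
  have /fine_cvgP[_ /cvgrPdist_lt/(_ q q0)] := cvg_cdfNy0 g.
  move=> [B [_ Bq]]; exists (B - 1) => v /= qv; rewrite leNgt; apply/negP => vB.
  have : `|0 - real_cdf v| < q by apply: Bq; rewrite /= (lt_trans vB)// gtrDl oppr_lt0.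
  by rewrite sub0r normrN ger0_norm ?fine_ge0// ltNge qv.
apply/eqP; rewrite eq_le; apply/andP; split; rewrite leNgt; apply/negP => h.
- have := near_xi (real_cdf xi - q); rewrite subr_gt0 => /(_ h)/nbhs_ballP[r /= r0 hr].
  have /hr : ball xi r (xi - r / 2).
    rewrite /ball/= opprB addrC subrK ger0_norm ?divr_ge0 ?ltW//.
    by rewrite ltr_pdivrMr// ltr_pMr// ltr1n.
  rewrite ger0_norm ?subr_ge0; last first.
    by apply: real_cdf_le; rewrite lerBlDr lerDl divr_ge0// ltW.
  move=> h2; have : A (xi - r / 2) by rewrite /A/=; lra.
  by move/(ge_inf hA); rewrite -xiE; lra.
- have := near_xi (q - real_cdf xi); rewrite subr_gt0 => /(_ h)/nbhs_ballP[r /= r0 hr].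
  have [v Av vr] := @inf_adherent _ A r r0 (conj A0 hA).
  have xiv : xi <= v by rewrite xiE; exact: ge_inf.
  have /hr : ball xi r v.
    by rewrite /ball/= distrC ger0_norm ?subr_ge0// ltrBlDl xiE.
  rewrite distrC ger0_norm ?subr_ge0; last exact: real_cdf_le.
  by move: Av; rewrite /A/=; lra.
Qed.

(** The sign turns the lower bound on the number of observations below y into an
    upper bound on a sum. *)
Definition centred (y : R) (x : S) : R := real_cdf y - \1_[set z | g z <= y] x.

Let mlevel y : measurable [set z | g z <= y].
Proof.
rewrite (_ : mkset _ = g @^-1` `]-oo, y]%classic).
  exact: measurable_funPTI.
by apply/seteqP; split => z /=; rewrite in_itv.
Qed.

Let bI y : bmf (\1_[set z | g z <= y] : S -> R).
Proof. by apply: bmf_indic; exact: mlevel. Qed.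

Lemma bmf_centred y : bmf (centred y).
Proof. by apply: bmfB => //; exact: bmf_cst. Qed.

Lemma mean_level y : \int[pi]_x \1_[set z | g z <= y] x = real_cdf y.
Proof.
by rewrite mean_indic; [congr (fine (pi _))|exact: mlevel].
Qed.

Lemma mean_centred y : \int[pi]_x centred y x = 0.
Proof.
by rewrite (meanB pi1)//; [rewrite mean_cst// mean_level subrr|exact: bmf_cst].
Qed.

Lemma centred_le1 y x : `|centred y x| <= 1.
Proof.
have F0 : 0 <= real_cdf y by exact: fine_ge0.
have F1 : real_cdf y <= 1 by rewrite -lee_fin real_cdfE cdf_le1.
rewrite /centred indicE; case: (_ \in _) => /=; last by rewrite subr0 ger0_norm.
by rewrite distrC ger0_norm ?subr_ge0// lerBlDr lerDl.
Qed.

(** The indicators are ordered, so the mean distance between them is the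
    difference of their means; the centrings differ by the same amount. *)
Lemma centred_distance y z :
  \int[pi]_x `|centred y x - centred z x| <= 2 * `|real_cdf y - real_cdf z|.
Proof.
wlog yz : y z / y <= z.
  move=> H; have [|/ltW zy] := leP y z; first exact: H.
  rewrite distrC; apply: le_trans (H _ _ zy).
  by rewrite le_eqVlt; apply/orP; left; apply/eqP; apply: eq_Rintegral => x _;
    rewrite distrC.
pose J x : R := \1_[set t | g t <= z] x - \1_[set t | g t <= y] x.
have J0 x : 0 <= J x.
  rewrite subr_ge0 !indicE ler_nat; case: (boolP (x \in [set t | g t <= y])) => //.
  by rewrite inE /= => /le_trans/(_ yz) xz; rewrite mem_set.
have bJ : bmf J by exact: bmfB.
apply: (@le_trans _ _ (\int[pi]_x (`|real_cdf y - real_cdf z| + J x))).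
  apply: le_mean => //.
  - by apply: bmf_norm; apply: bmfB; exact: bmf_centred.
  - by apply: bmfD => //; exact: bmf_cst.
  - move=> x; rewrite /centred -[X in _ <= _ + X](ger0_norm (J0 x)).
    apply: le_trans (ler_normD _ _); rewrite le_eqVlt; apply/orP; left; apply/eqP.
    by congr `|_|; rewrite /J; ring.
rewrite (meanD pi1)//; last exact: bmf_cst.
rewrite mean_cst// (meanB pi1)// !mean_level.
rewrite mulr_natl mulr2n lerD2l distrC ger0_norm// subr_ge0.
exact: real_cdf_le.
Qed.

End quantile_density.

Section asymptotic_variance_limit.
Context d (S : measurableType d) (R : realType).
Variables (P : R.-pker S ~> S) (pi : probability S R) (g : {RV pi >-> R}).
Hypothesis Ppi : invariant_distribution P pi.

Let pi1 : pi setT = 1%E. Proof. exact: probability_setT. Qed.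

Lemma autocov_centred (y : R) (k : nat) :
  let I : S -> R := \1_[set z | g z <= y] in
  autocov P pi (centred g y) k =
  fine (covariance (pair_law pi (nstep P k)) (I \o fst) (I \o snd)).
Proof.
move=> I; have bI : bmf I.
  apply: bmf_indic; rewrite (_ : mkset _ = g @^-1` `]-oo, y]%classic).
    exact: measurable_funPTI.
  by apply/seteqP; split => z /=; rewrite in_itv.
have b1 : bmf (fun _ : S => 1 : R) by exact: bmf_cst.
have P1 x : nstep P k x setT = 1%E by exact: prob_kernel.
have c1 : \int[pair_law pi (nstep P k)]_z (I \o fst) z = real_cdf g y.
  transitivity (\int[pair_law pi (nstep P k)]_z (I z.1 * 1)).
    by apply: eq_Rintegral => z _; rewrite mulr1.
  rewrite (mean_pair_law _ _ bI b1) -mean_level; apply: eq_Rintegral => x _.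
  by rewrite /kmean mean_cst// mulr1.
have c2 : \int[pair_law pi (nstep P k)]_z (I \o snd) z = real_cdf g y.
  transitivity (\int[pair_law pi (nstep P k)]_z (1 * I z.2)).
    by apply: eq_Rintegral => z _; rewrite mul1r.
  rewrite (mean_pair_law _ _ b1 bI) -mean_level -(mean_invariant_nstep Ppi k bI).
  by apply: eq_Rintegral => x _; rewrite mul1r.
rewrite covariance_mean c1 c2 /autocov.
rewrite -(mean_pair_law _ _ (bmf_centred g y) (bmf_centred g y)).
apply: eq_Rintegral => z _; rewrite /centred /=.
by rewrite -mulrNN !opprB.
Qed.

Lemma autocov_centred0 (y : R) :
  let I : S -> R := \1_[set z | g z <= y] in
  autocov P pi (centred g y) 0 = fine 'V_pi[I].
Proof.
move=> I.
rewrite /variance covariance_mean mean_level /autocov kmean_nstep0.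
  by apply: eq_Rintegral => x _; rewrite /centred -mulrNN !opprB.
exact: bmf_centred.
Qed.

(** The series of the covariances converges absolutely, and the truncated
    variances are its partial sums at l n. *)
Lemma cvg_truncated_variance (y C : R) (l : nat -> nat) :
  (forall n, \sum_(1 <= k < n) `|autocov P pi (centred g y) k| <= C) ->
  l n @[n --> \oo] --> \oo ->
  truncated_variance P pi (centred g y) (l n) @[n --> \oo] -->
  asymptotic_variance P g y.
Proof.
move=> sC lo; pose u := autocov P pi (centred g y).
have cu : cvgn (fun n => \sum_(1 <= k < n) u k).
  rewrite (is_cvg_series_restrict 1%N u).
  apply: normed_cvg.
  rewrite -(is_cvg_series_restrict 1%N (fun k => `|u k|)).
  apply: nondecreasing_is_cvgn.
    apply/nondecreasing_seqP => n /=.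
    have [->|n0] := posnP n; first by rewrite !big_geq.
    by rewrite big_nat_recr//= lerDl.
  by exists C => _ [n _ <-]; exact: sC.
rewrite /asymptotic_variance -autocov_centred0 /truncated_variance -/u.
rewrite (_ : (fun n => \sum_(1 <= k < n) fine _) = (fun n => \sum_(1 <= k < n) u k));
  last by apply/funext => n; apply: eq_bigr => k _; rewrite /u autocov_centred.
apply: cvgD; first exact: cvg_cst.
apply: cvgM; first exact: cvg_cst.
have lS : (l n).+1 @[n --> \oo] --> \oo.
  apply/cvgnyPge => N; move/cvgnyPge/(_ N) : lo; apply: filterS => n /leq_trans.
  by apply.
exact: (cvg_comp _ _ lS cu).
Qed.

End asymptotic_variance_limit.

(** * The sample quantile *)

Section sample_quantile_clt.
Context dO (Omega : measurableType dO) d (S : measurableType d) (R : realType).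
Variable Pr : probability Omega R.
Variable X : nat -> {RV Pr >-> S}.
Variables (P : R.-pker S ~> S) (pi : probability S R) (g : {RV pi >-> R}).
Variables (q : R) (f : R -> R) (m : R).
Hypothesis q01 : 0 < q < 1.

Let Y (i : nat) : {RV Pr >-> R} := g \o X i.

Definition rank (n : nat) : nat := `|Num.ceil (n%:R * q)|%N.

Let q0 : 0 < q. Proof. by case/andP: q01. Qed.

Lemma rank_itv n : n%:R * q <= (rank n)%:R < n%:R * q + 1.
Proof.
have nq0 : 0 <= n%:R * q by rewrite mulr_ge0// ltW.
have -> : (rank n)%:R = (Num.ceil (n%:R * q))%:~R :> R.
  by rewrite /rank natr_absz ger0_norm// ceil_ge0 (lt_le_trans _ nq0)// ltrN10.
by have := ceil_itv (n%:R * q); rewrite intrD mulrN1z ltrBlDr andbC.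
Qed.

Lemma rank_bounds n : (0 < n)%N -> (0 < rank n <= n)%N.
Proof.
move=> n0; have /andP[r1 r2] := rank_itv n.
have nq : 0 < n%:R * q by rewrite mulr_gt0// ltr0n.
rewrite -(ltr_nat R) (lt_le_trans nq r1)/= -ltnS -(ltr_nat R) (lt_le_trans r2)//.
rewrite -natr1 lerD2r ler_piMr//; by case/andP: q01 => _ /ltW.
Qed.

Lemma sample_quantile_le n (y : R) (w : Omega) : (0 < n)%N ->
  (sample_quantile Y q n w <= y) =
  ((rank n)%:R <= \sum_(0 <= i < n) \1_[set z | g z <= y] (X i w) :> R).
Proof.
move=> n0; have /andP[j0 jn] := rank_bounds n0.
rewrite /sample_quantile /order_statistic -/(rank n) nth_sort_le; last first.
  by rewrite size_map size_iota prednK.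
rewrite prednK// -(ler_nat R) count_map -sum1_count natr_sum [in LHS]big_mkcond/=.
congr (_ <= _); rewrite /index_iota subn0; apply: eq_bigr => i _; rewrite indicE.
by case: ifPn => h; [rewrite mem_set|rewrite memNset//; exact/negP].
Qed.

Hypothesis gf : continuous_density g f.

Let xi := quantile g q.
Variable x : R.
Let y (n : nat) : R := xi + x * rsqrt n.

Definition threshold (n : nat) : R :=
  rsqrt n * (n%:R * real_cdf g (y n) - (rank n)%:R).

Lemma scaled_error_le n (w : Omega) : (0 < n)%N ->
  (scaled_error Y q xi n w <= x) =
  (partial_sum X (centred g (y n)) (rsqrt n) n w <= threshold n).
Proof.
move=> n0; have s0 := rsqrt_gt0 R n0.
have n0' : 0 < Num.sqrt n%:R :> R by rewrite sqrtr_gt0 ltr0n.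
rewrite /scaled_error -ler_pdivlMl// lerBlDl mulrC -/(rsqrt n) -/(y n).
rewrite sample_quantile_le// /partial_sum /threshold ler_pM2l//.
rewrite /centred sumrB big_const_nat subn0 iter_addr_0 -[X in _ = (X - _ <= _)]mulr_natl.
by rewrite lerD2l lerN2.
Qed.

(* x = 0 is allowed, hence the divisor |x| + 1. *)
Let cvg_increment (v : R) : (rsqrt n)^-1 * (real_cdf g (v + x * rsqrt n) - real_cdf g v)
  @[n --> \oo] --> x * f v.
Proof.
apply/cvgrPdist_le => /= eps eps0.
have e0 : 0 < eps / (`|x| + 1) by rewrite divr_gt0// ltr_wpDl.
have cx : x * rsqrt n @[n --> \oo] --> (0 : R).
  by rewrite -(mulr0 x); apply: cvgM; [exact: cvg_cst|exact: cvg_rsqrt].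
have near_n := cx _ (real_cdf_expansion gf v e0).
near=> n.
have n0 : (0 < n)%N by near: n; exists 1%N.
have s0 := rsqrt_gt0 R n0.
have H : `|real_cdf g (v + x * rsqrt n) - real_cdf g v - f v * (x * rsqrt n)|
    <= eps / (`|x| + 1) * `|x * rsqrt n| by near: n; exact: near_n.
rewrite distrC.
have -> : (rsqrt n)^-1 * (real_cdf g (v + x * rsqrt n) - real_cdf g v) - x * f v =
    (rsqrt n)^-1 * (real_cdf g (v + x * rsqrt n) - real_cdf g v - f v * (x * rsqrt n)).
  by field; rewrite gt_eqF.
rewrite normrM ger0_norm ?invr_ge0 ?(ltW s0)// mulrC ler_pdivrMr//.
apply: (le_trans H); rewrite normrM (ger0_norm (ltW s0)) mulrA ler_pM2r//.
by rewrite mulrAC ler_pdivrMr ?ltr_wpDl// ler_wpM2l ?(ltW eps0)// lerDl.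
Unshelve. all: by end_near. Qed.

(** n^(1/2) (F(xi + x n^(-1/2)) - q) tends to x f(xi), and replacing n q by the
    rank changes the threshold by at most n^(-1/2). *)
Lemma cvg_threshold : threshold n @[n --> \oo] --> x * f xi.
Proof.
have Fxi : real_cdf g xi = q by exact: (real_cdf_quantile gf q01).
have c1 := @cvg_increment xi; rewrite Fxi in c1.
have cr : rsqrt n * ((rank n)%:R - n%:R * q) @[n --> \oo] --> (0 : R).
  apply: (@squeeze_cvgr _ _ _ _ (fun=> 0) (fun n => rsqrt n)).
  - near=> n; have /andP[r1 r2] := rank_itv n.
    rewrite mulr_ge0 ?rsqrt_ge0 ?subr_ge0//= ler_piMr ?rsqrt_ge0//.
    by rewrite lerBlDl ltW.
  - exact: cvg_cst.
  - exact: cvg_rsqrt.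
have c2 : (rsqrt n)^-1 * (real_cdf g (y n) - q) - rsqrt n * ((rank n)%:R - n%:R * q)
    @[n --> \oo] --> x * f xi.
  by rewrite -[X in _ --> X]subr0; exact: cvgB c1 cr.
apply: cvg_trans c2; apply: near_eq_cvg.
near=> n; have n0 : (0 < n)%N by near: n; exists 1%N.
have s0 := rsqrt_gt0 R n0.
have ns : n%:R * rsqrt n = (rsqrt n)^-1 :> R.
  have s1 : rsqrt n != 0 :> R by rewrite gt_eqF.
  by apply: (mulIf s1); rewrite -mulrA -expr2 mulr_rsqrt2// mulVf.
by rewrite /= -ns /threshold /y; ring.
Unshelve. all: by end_near. Qed.

Hypothesis XP : markov_chain P X.
Hypothesis Ppi : invariant_distribution P pi.
Hypothesis m1 : 1 < m.
Hypothesis Pm : polynomially_ergodic P pi m.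
Hypothesis sigma2_gt0 : 0 < asymptotic_variance P g xi.

(** The variances of the array converge because l n^(-1/2) tends to 0 while
    n^(1/2) |F(y_n) - F(xi)| stays bounded. *)
Theorem cvg_scaled_error :
  fine (Pr [set w | scaled_error Y q xi n w <= x]) @[n --> \oo] -->
  Phi (x * f xi / Num.sqrt (asymptotic_variance P g xi)).
Proof.
have [M [mM M0 iM TVM]] := Pm.
have [l [l0 lsmall llarge linf]] := window_lengths m1.
have [C C0 rC] := power_sum_bounded m1.
have bc v := bmf_centred g v.
have c1 v z := centred_le1 g v z.
have c0 v := mean_centred g v.
have sumC n : \sum_(1 <= k < n) `|autocov P pi (centred g xi) k| <=
    2 * mean_rate pi M * C.
  apply: (@le_trans _ _ (\sum_(1 <= k < n) 2 * mean_rate pi M * k%:R `^ (- m))).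
    rewrite big_nat [leRHS]big_nat ler_sum// => k /andP[k0 _].
    exact: (autocov_bound mM M0 iM TVM (bc xi).1 (c1 xi) (c0 xi) k0).
  rewrite -mulr_sumr ler_wpM2l// mulr_ge0// mean_rate_ge0//.
have cv := cvg_truncated_variance Ppi sumC linf.
have cvn : truncated_variance P pi (centred g (y n)) (l n) @[n --> \oo] -->
    asymptotic_variance P g xi.
  have dist0 : truncated_variance P pi (centred g (y n)) (l n) -
      truncated_variance P pi (centred g xi) (l n) @[n --> \oo] --> (0 : R).
    pose D n := `|real_cdf g (y n) - real_cdf g xi|.
    have D0 : (rsqrt n)^-1 * D n @[n --> \oo] --> `|x * f xi|.
      rewrite (_ : (fun n => _) = fun n => `|(rsqrt n)^-1 * (real_cdf g (y n) - real_cdf g xi)|).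
        exact: cvg_norm (@cvg_increment xi).
      by apply/funext => n; rewrite normrM ger0_norm ?invr_ge0 ?rsqrt_ge0.
    have E0 : (2 * rsqrt n + 4 * (rsqrt n * (l n)%:R)) * (2 * ((rsqrt n)^-1 * D n))
        @[n --> \oo] --> (2 * 0 + 4 * 0) * (2 * `|x * f xi|).
      by apply: cvgM; [apply: cvgD|]; apply: cvgM => //;
        [exact: cvg_cst|exact: cvg_rsqrt|exact: cvg_cst|exact: cvg_cst].
    rewrite !mulr0 addr0 mul0r in E0.
    apply/cvgr0Pnorm_le => /= eps eps0.
    have /cvgr0Pnorm_le/(_ _ eps0) E1 := E0.
    near=> n; have n0 : (0 < n)%N by near: n; exists 1%N.
    have s0 := rsqrt_gt0 R n0.
    have := truncated_variance_lipschitz Ppi (l n) (bc (y n)) (bc xi) (c1 (y n)) (c1 xi).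
    move=> /le_trans; apply.
    apply: (@le_trans _ _ ((2 + 4 * (l n)%:R) * (2 * D n))).
      by rewrite ler_wpM2l ?centred_distance.
    have -> : (2 + 4 * (l n)%:R) * (2 * D n) =
        (2 * rsqrt n + 4 * (rsqrt n * (l n)%:R)) * (2 * ((rsqrt n)^-1 * D n)).
      by field; rewrite gt_eqF.
    by apply: le_trans (ler_norm _) _; near: n; exact: E1.
  rewrite -[X in _ --> X]add0r (_ : (fun n => _) = fun n =>
    truncated_variance P pi (centred g (y n)) (l n) -
    truncated_variance P pi (centred g xi) (l n) +
    truncated_variance P pi (centred g xi) (l n)); first exact: cvgD dist0 cv.
  by apply/funext => n; rewrite subrK.
have clt := triangular_clt XP m1 mM M0 iM TVM (fun n => (bc (y n)).1) (fun n => c1 (y n))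
  (fun n => c0 (y n)) sigma2_gt0 l0 lsmall llarge cvn cvg_threshold.
apply: cvg_trans clt; apply: near_eq_cvg; near=> n.
have n0 : (0 < n)%N by near: n; exists 1%N.
congr (fine (Pr _)); apply/seteqP; split => w /=; by rewrite scaled_error_le.
Unshelve. all: by end_near. Qed.

End sample_quantile_clt.

Theorem theorem4 (R : realType) (d : nat) (d_gt0 : (0 < d)%N)
    (SX : set (d.-tuple R)) (SX0 : SX !=set0) (mSX : measurable SX)
    (pi : probability (state SX0) R) (pi_support : full_support pi)
    (P : R.-pker (state SX0) ~> (state SX0))
    (dO : measure_display) (Omega : measurableType dO)
    (Pr : probability Omega R) (X : nat -> {RV Pr >-> state SX0})
    (g : {RV pi >-> R}) (q : R) (f : R -> R) (m : R) :
  markov_chain P X ->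
  harris_ergodic P pi ->
  0 < q < 1 ->
  continuous_density g f ->
  0 < f (quantile g q) ->
  1 < m -> polynomially_ergodic P pi m ->
  0 < asymptotic_variance P g (quantile g q) ->
  cvg_in_distribution
    (fun n => scaled_error (fun i => (g \o X i : {RV Pr >-> R}))
                q (quantile g q) n : {RV Pr >-> R})
    (normal_prob 0
      (Num.sqrt (asymptotic_variance P g (quantile g q)
                 / f (quantile g q) ^+ 2))).
Proof.
move=> XP [_ _ _ Ppi] q01 gf f0 m1 Pm v0 x _.
have sE : Num.sqrt (asymptotic_variance P g (quantile g q) / f (quantile g q) ^+ 2) =
    Num.sqrt (asymptotic_variance P g (quantile g q)) / f (quantile g q).
  by rewrite sqrtrM ?(ltW v0)// sqrtrV ?sqr_ge0// sqrtr_sqr gtr0_norm.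
have s0 : 0 < Num.sqrt (asymptotic_variance P g (quantile g q)) / f (quantile g q).
  by rewrite divr_gt0// sqrtr_gt0.
rewrite [X in _ --> X](_ : _ = (Phi (x * f (quantile g q) /
    Num.sqrt (asymptotic_variance P g (quantile g q))))%:E); last first.
  by rewrite sE -mulrA -[X in Phi (x * X)]invf_div; exact: PhiE.
have clt := @cvg_scaled_error _ _ _ _ _ _ X P pi g q f m q01 gf x XP Ppi m1 Pm v0.
apply/fine_cvgP; split; first by apply: nearW => n; rewrite fin_num_measure.
rewrite (_ : fine \o _ = fun n => fine (Pr [set w |
  scaled_error (fun i => g \o X i : {RV Pr >-> R}) q (quantile g q) n w <= x]))//.
Qed.
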